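(* Let $n\ge 1$, $\lambda>0$, and let $\boldsymbol p$ and $\boldsymbol q$ be two partitions of $n$ such that $\chi_{\boldsymbol p}(1)\neq\chi_{\boldsymbol q}(1)$. Then: (a) the sub-modules $\mathbb P_{\boldsymbol p}^{ii}\big(\mathbb A^{(\lambda)}(\mathbb D^n)\big)$ and $\mathbb P_{\boldsymbol q}^{jj}\big(\mathbb A^{(\lambda)}(\mathbb D^n)\big)$ (over $\mathbb C[\boldsymbol z]^{\mathfrak S_n}$) are not equivalent for any $i,j$ with $1\le i\le\chi_{\boldsymbol p}(1)$ and $1\le j\le\chi_{\boldsymbol q}(1)$; (b) the sub-modules $\mathbb P_{\boldsymbol p}\big(\mathbb A^{(\lambda)}(\mathbb D^n)\big)$ and $\mathbb P_{\boldsymbol q}\big(\mathbb A^{(\lambda)}(\mathbb D^n)\big)$ (over $\mathbb C[\boldsymbol z]^{\mathfrak S_n}$) are not equivalent.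
   Context: $\mathbb D^n$ is the open unit polydisc in $\mathbb C^n$. For $\lambda>0$, $\mathbb A^{(\lambda)}(\mathbb D^n)$ is the Hilbert space of holomorphic functions on $\mathbb D^n$ with reproducing kernel $K^{(\lambda)}(\boldsymbol z,\boldsymbol w)=\prod_{j=1}^n(1-z_j\bar w_j)^{-\lambda}$. The symmetric group $\mathfrak S_n$ acts on $\mathbb C^n$ by $\sigma\cdot\boldsymbol z=(z_{\sigma^{-1}(1)},\dots,z_{\sigma^{-1}(n)})$, and $(f\circ\sigma^{-1})(\boldsymbol z)=f(\sigma^{-1}\cdot\boldsymbol z)$. $\mathbb C[\boldsymbol z]^{\mathfrak S_n}$ is the ring of symmetric polynomials in $z_1,\dots,z_n$; $\mathbb A^{(\lambda)}(\mathbb D^n)$ is a Hilbert module over it by pointwise multiplication. For each partition $\boldsymbol p$ of $n$ fix a unitary matrix representation $\boldsymbol\pi_{\boldsymbol p}(\sigma)=\big(\boldsymbol\pi_{\boldsymbol p}^{ij}(\sigma)\big)_{i,j}$ in the equivalence class of irreducible representations of $\mathfrak S_n$ corresponding to $\boldsymbol p$, with character $\chi_{\boldsymbol p}$ and dimension $\chi_{\boldsymbol p}(1)$. On $\mathbb A^{(\lambda)}(\mathbb D^n)$ define, for $1\le i,j\le\chi_{\boldsymbol p}(1)$, $\mathbb P_{\boldsymbol p}^{ij}f=\frac{\chi_{\boldsymbol p}(1)}{n!}\sum_{\sigma\in\mathfrak S_n}\boldsymbol\pi_{\boldsymbol p}^{ji}(\sigma^{-1})(f\circ\sigma^{-1})$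 and $\mathbb P_{\boldsymbol p}f=\sum_i\mathbb P_{\boldsymbol p}^{ii}f=\frac{\chi_{\boldsymbol p}(1)}{n!}\sum_{\sigma\in\mathfrak S_n}\overline{\chi_{\boldsymbol p}(\sigma)}(f\circ\sigma^{-1})$. The operators $\mathbb P_{\boldsymbol p}^{ii}$ and $\mathbb P_{\boldsymbol p}$ are orthogonal projections whose ranges are reducing submodules over $\mathbb C[\boldsymbol z]^{\mathfrak S_n}$. Two Hilbert modules over a ring of polynomials are equivalent if there is a unitary operator between them intertwining the module actions of every element of the ring. *)

(* Defs.v *)
From HB Require Import structures.
From mathcomp Require Import all_boot all_order all_algebra.
From mathcomp Require Import all_fingroup mxrepresentation complex.
From mathcomp Require Import all_classical all_reals all_analysis.
(* Not imported: the notations of mpoly clash with those of all_analysis. *)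
From mathcomp Require mpoly.

Set Implicit Arguments.
Unset Strict Implicit.
Unset Printing Implicit Defensive.

Import Order.TTheory GRing.Theory Num.Theory.
Import numFieldNormedType.Exports.

Local Open Scope classical_set_scope.
Local Open Scope ring_scope.

(* The complex numbers R[i], typed as a numClosedFieldType so that the order
   (x <= y iff y - x is a nonnegative real), norm and topology are inferred. *)
Definition Cplx (R : realType) : numClosedFieldType := R[i].

Definition is_partition (n : nat) (p : seq nat) : Prop :=
  [/\ sorted geq p, 0%N \notin p & sumn p = n].

(* The cell of number k in the tableau of shape p filled row by row with
   0, 1, ..., n - 1 lies in row [reshape_index p k] and column
   [reshape_offset p k]. *)
Definition row_group (n : nat) (p : seq nat) : {set 'S_n} :=
  [set s : 'S_n |
    [forall k : 'I_n, reshape_index p (s k) == reshape_index p k]].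

Definition col_group (n : nat) (p : seq nat) : {set 'S_n} :=
  [set s : 'S_n |
    [forall k : 'I_n, reshape_offset p (s k) == reshape_offset p k]].

(* In ['S_n] the product [s * t] means "s, then t", so the textbook product
   a o b in the group algebra is [b * a] here, and left ideals become right
   ideals.  The symmetrizer is the sum of the sgn(b) (a o b), with a (resp. b)
   preserving the rows (resp. columns). *)
Definition young_symmetrizer (F : fieldType) (n : nat) (p : seq nat) :=
  \sum_(a in row_group n p) \sum_(b in col_group n p)
    (-1) ^+ odd_perm b *:
      gring_row (regular_repr F [group of [set: 'S_n]] (b * a)%g).

Definition specht_repr (F : fieldType) (n : nat) (p : seq nat) :=
  submod_repr
    (cyclic_mx_module (regular_repr F [group of [set: 'S_n]])
       (young_symmetrizer F n p)).

Section Repr.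
Variables (R : realType) (n d : nat).
Local Notation C := (Cplx R).
Variable rG : mx_representation C [group of [set: 'S_n]] d.

(* A [mx_representation] acts on row vectors: rG (s * t) = rG s *m rG t with
   s * t = t o s.  Transposing gives matrices acting on column vectors, with
   rep_mat (s o t) = rep_mat s *m rep_mat t. *)
Definition rep_mat (s : 'S_n) : 'M[C]_d := (rG s)^T.

Definition chi (s : 'S_n) : C := \tr (rep_mat s).

Definition unitary_irrep_of (p : seq nat) : Prop :=
  [/\ mx_irreducible rG,
      mx_rsim rG (specht_repr C n p)
    & forall s, rep_mat s \is unitarymx].

End Repr.

Section Polydisc.
Variables (R : realType) (n : nat).
Local Notation C := (Cplx R).

Definition in_polydisc (z : 'rV[C]_n) : bool := [forall i, `|z 0 i| < 1].

Definition polydisc := {z : 'rV[C]_n | in_polydisc z}.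

Definition coord (z : polydisc) (i : 'I_n) : C := val z 0 i.

(* s . z = (z_(s^-1 1), ..., z_(s^-1 n)) *)
Definition perm_row (s : 'S_n) (z : 'rV[C]_n) : 'rV[C]_n :=
  \row_i z 0 (s^-1%g i).

Lemma perm_row_polydisc (s : 'S_n) (z : polydisc) :
  in_polydisc (perm_row s (val z)).
Proof. by apply/forallP => i; rewrite mxE; have /forallP := valP z; apply. Qed.

Definition perm_pt (s : 'S_n) (z : polydisc) : polydisc :=
  exist _ (perm_row s (val z)) (perm_row_polydisc s z).

(* The value 0 off the polydisc is irrelevant below, the polydisc being open. *)
Definition extend (f : polydisc -> C) (z : 'rV[C]_n) : C^o :=
  oapp f 0 (insub z).

Definition holomorphic (f : polydisc -> C) : Prop :=
  forall z : polydisc, differentiable (extend f) (val z).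

(* Principal value of u ^ a, for Re u > 0 (where the argument is an atan). *)
Definition cpow (u : C) (a : R) : C :=
  let r := complex.Re `|u| `^ a in
  let t := a * atan (complex.Im u / complex.Re u) in
  Complex (r * cos t) (r * sin t).

Definition bergman_kernel (lam : R) (z w : polydisc) : C :=
  \prod_(j < n) cpow (1 - coord z j * (coord w j)^*) (- lam).

Definition hnorm (ip : (polydisc -> C) -> (polydisc -> C) -> C)
    (f : polydisc -> C) : R :=
  Num.sqrt (complex.Re (ip f f)).

(* H, with the inner product ip (linear on the left; only its values on H
   matter), is a Hilbert space of functions on the polydisc. *)
Record is_hilbert_function_space (H : set (polydisc -> C))
    (ip : (polydisc -> C) -> (polydisc -> C) -> C) : Prop := {
  hfs_zero : H (fun=> 0);
  hfs_lin : forall (a : C) f g, H f -> H g -> H (fun z => a * f z + g z);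
  hfs_ip_lin : forall (a : C) f g h, H f -> H g -> H h ->
    ip (fun z => a * f z + g z) h = a * ip f h + ip g h;
  hfs_ip_conj : forall f g, H f -> H g -> ip g f = (ip f g)^*;
  hfs_ip_ge0 : forall f, H f -> 0 <= ip f f;
  hfs_ip_def : forall f, H f -> ip f f = 0 -> f = (fun=> 0);
  hfs_complete : forall u : nat -> polydisc -> C,
    (forall k, H (u k)) ->
    (forall e : R, 0 < e -> exists N : nat, forall k m : nat,
       (N <= k)%N -> (N <= m)%N -> hnorm ip (fun z => u k z - u m z) < e) ->
    exists2 f, H f &
      forall e : R, 0 < e -> exists N : nat, forall k : nat,
        (N <= k)%N -> hnorm ip (fun z => u k z - f z) < e
}.

Definition has_reproducing_kernel (H : set (polydisc -> C))
    (ip : (polydisc -> C) -> (polydisc -> C) -> C)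
    (K : polydisc -> polydisc -> C) : Prop :=
  forall w, H (K^~ w) /\ forall f, H f -> f w = ip f (K^~ w).

(* (H, ip) is the space A^(lam) of the polydisc; a Hilbert space of functions
   is determined by its reproducing kernel, so H and the values of ip on H are
   unique. *)
Definition is_bergman_space (lam : R) (H : set (polydisc -> C))
    (ip : (polydisc -> C) -> (polydisc -> C) -> C) : Prop :=
  [/\ is_hilbert_function_space H ip,
      forall f, H f -> holomorphic f
    & has_reproducing_kernel H ip (bergman_kernel lam)].

Definition Pij (d : nat) (rG : mx_representation C [group of [set: 'S_n]] d)
    (i j : 'I_d) (f : polydisc -> C) : polydisc -> C :=
  fun z => chi rG 1%g / (n`!)%:R *
    \sum_(s : 'S_n) rep_mat rG (s^-1)%g j i * f (perm_pt (s^-1)%g z).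

Definition Pp (d : nat) (rG : mx_representation C [group of [set: 'S_n]] d)
    (f : polydisc -> C) : polydisc -> C :=
  fun z => \sum_(i < d) Pij rG i i f z.

Definition poly_act (phi : mpoly.mpoly n C) (f : polydisc -> C) :
    polydisc -> C :=
  fun z => mpoly.meval (coord z) phi * f z.

(* M1 and M2 are submodules of a same space with inner product ip; U is only
   relevant on M1. *)
Definition module_equiv (ip : (polydisc -> C) -> (polydisc -> C) -> C)
    (M1 M2 : set (polydisc -> C)) : Prop :=
  exists U : (polydisc -> C) -> (polydisc -> C),
    [/\ U @` M1 = M2,
        forall (a : C) f g, M1 f -> M1 g ->
          U (fun z => a * f z + g z) = (fun z => a * U f z + U g z),
        forall f g, M1 f -> M1 g -> ip (U f) (U g) = ip f g
      & forall phi, phi \is @mpoly.symmetric n C ->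
          forall f, M1 f -> U (poly_act phi f) = poly_act phi (U f)].

End Polydisc.

(* Main.v *)
(** Fix a point w of the polydisc with distinct coordinates. A unitary module map
    commutes with the adjoints of the multiplications by symmetric polynomials, so
    it maps joint eigenvectors of these adjoints with eigenvalue phi |-> phi(w) to
    joint eigenvectors. In A^(lambda) these eigenvectors are exactly the linear
    combinations of the n! reproducing kernels at the points of the orbit of w: an
    eigenvector is determined by its inner products with the polynomials, and a
    linear functional L on polynomials with L (phi f) = phi(w) L(f) is a combination
    of the evaluations on the orbit, by Cramer's rule over symmetric polynomials.
    On the span of these kernels the projections P^ii and P act as idempotent
    elements of the group algebra, whose ranks are their traces chi(1) and
    chi(1)^2, and these ranks are invariants of the submodules.

    Everything about A^(lambda) is derived from its kernel: the binomial series
    gives the power series of the kernel, discrete Fourier averages of kernels over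
    tori converge in norm to multiples of the monomials, and the monomials are then
    an orthogonal system with dense span, on which permutations of the variables
    are isometric and multiplications by polynomials bounded. *)
Require Import Defs.
From HB Require Import structures.
From mathcomp Require Import all_boot all_order all_algebra.
From mathcomp Require Import all_fingroup mxrepresentation complex.
From mathcomp Require Import all_classical all_reals all_analysis.
From mathcomp Require Import ring lra.
From mathcomp Require Import -(notations) mpoly.

Set Implicit Arguments.
Unset Strict Implicit.
Unset Printing Implicit Defensive.

Import Order.TTheory GRing.Theory Num.Theory.
Import numFieldNormedType.Exports.

Local Open Scope classical_set_scope.
Local Open Scope ring_scope.

(** * Binomial series *)

Section BinomialCoefficients.
Variable R : realType.
Implicit Types (lam y : R) (k : nat).

(** The coefficient of x^k in (1 - x)^(-lam), that is lam (lam + 1) ... (lam + k - 1) / k!. *)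
Definition bcoef lam k : R := \prod_(i < k) ((lam + i%:R) / i.+1%:R).

Lemma bcoef0 lam : bcoef lam 0 = 1.
Proof. exact: big_ord0. Qed.

Lemma bcoefS lam k : k.+1%:R * bcoef lam k.+1 = (lam + k%:R) * bcoef lam k.
Proof.
by rewrite /bcoef big_ord_recr/= mulrCA [_ * (_ / _)]mulrC divfK ?pnatr_eq0// mulrC.
Qed.

Lemma bcoef_gt0 lam k : 0 < lam -> 0 < bcoef lam k.
Proof.
move=> lam_gt0; apply: prodr_gt0 => i _.
by rewrite divr_gt0// ltr_wpDr.
Qed.

(** Coefficientwise form of the rule that the derivative of (1 - x)^(-lam) is lam (1 - x)^(-lam -
    1): the differentiated series is again binomial, with parameter [lam + 1]. *)
Lemma bcoef_shift lam k : k.+1%:R * bcoef lam k.+1 = lam * bcoef (lam + 1) k.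
Proof.
rewrite bcoefS; elim: k => [|k IH]; first by rewrite !bcoef0 addr0.
have k0 : k.+1%:R != 0 :> R by rewrite pnatr_eq0.
apply: (mulfI k0); rewrite mulrCA bcoefS.
rewrite [_ * (lam * _)]mulrCA bcoefS mulrCA [X in _ = X]mulrCA -IH -natr1.
by ring.
Qed.

(** Consecutive terms have ratio (lam + k) y / (k + 1), which is at most 1 as soon as k >= lam y /
    (1 - y). The terms before that rank are bounded by their sum. *)
Lemma bcoef_pow_bounded lam y : 0 < lam -> 0 <= y < 1 ->
  exists B, forall k, bcoef lam k * y ^+ k <= B.
Proof.
move=> lam_gt0 /andP[y0 y1].
have u0 k : 0 <= bcoef lam k * y ^+ k by rewrite mulr_ge0 ?exprn_ge0// ltW ?bcoef_gt0.
pose K := (Num.bound (lam * y / (1 - y))).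
exists (\sum_(i < K.+1) bcoef lam i * y ^+ i) => k.
have small j : (j <= K)%N -> bcoef lam j * y ^+ j <= \sum_(i < K.+1) bcoef lam i * y ^+ i.
  rewrite -ltnS => jK; rewrite (bigD1 (Ordinal jK))//= lerDl.
  by apply: sumr_ge0.
elim: k => [|k IH]; first exact: small.
have [kK|Kk] := leqP k.+1 K; first exact: small.
apply: le_trans IH; have k0 : 0 < k.+1%:R :> R by rewrite ltr0n.
rewrite -(ler_pM2l k0) mulrA bcoefS exprS -mulrA mulrCA.
rewrite [X in X <= _](_ : _ = ((lam + k%:R) * y) * (bcoef lam k * y ^+ k)); last by ring.
apply: ler_wpM2r => //.
have h : lam * y / (1 - y) <= k%:R.
  apply: ltW; apply: lt_le_trans (_ : K%:R <= _); last by rewrite ler_nat.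
  by apply: archi_boundP; rewrite divr_ge0 ?mulr_ge0 ?subr_ge0// ltW.
move: h; rewrite ler_pdivrMr ?subr_gt0// -natr1; lra.
Qed.

(** Abel's lemma, by comparison with a geometric series of ratio |K| / y. *)
Lemma cvg_pseries_bounded (f : nat -> R) (y B K : R) :
  (forall k, `|f k| * y ^+ k <= B) -> `|K| < y -> cvgn (pseries f K).
Proof.
move=> fB Ky; have y0 : 0 < y by apply: le_lt_trans Ky.
have q1 : `|K| / y < 1 by rewrite ltr_pdivrMr// mul1r.
apply: normed_cvg.
apply: (@series_le_cvg _ _ (fun k => B * (`|K| / y) ^+ k)).
- by move=> k; exact: normr_ge0.
- move=> k; rewrite mulr_ge0 ?exprn_ge0 ?divr_ge0// ?(ltW y0)//.
  by apply: le_trans (fB 0%N); rewrite expr0 mulr1.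
- move=> k /=; rewrite normrM normrX expr_div_n mulrA ler_pdivlMr ?exprn_gt0//.
  by rewrite mulrAC ler_wpM2r ?exprn_ge0.
- apply: is_cvg_geometric_series.
  by rewrite ger0_norm// divr_ge0// ltW.
Qed.

End BinomialCoefficients.

(** * The series of (1 - t x)^(-lam) as a real power series in t *)

Section BinomialSeries.
Variables (R : realType) (lam rho y : R).
Hypotheses (lam_gt0 : 0 < lam) (rho_ge0 : 0 <= rho) (rho_lt1 : rho < 1).
Hypotheses (y_gt1 : 1 < y) (rhoy_lt1 : rho * y < 1).

Let rhoy : 0 <= rho * y < 1.
Proof. by rewrite rhoy_lt1 mulr_ge0// ltW// (lt_trans _ y_gt1). Qed.

Let cvg_coef (mu : R) (c : R) (g : nat -> R) (K : R) : 0 < mu ->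
  (forall k, `|g k| <= rho ^+ k) -> `|K| < y ->
  cvgn (pseries (fun k => c * (bcoef mu k * g k)) K).
Proof.
move=> mu0 gle; have [B HB] := bcoef_pow_bounded mu0 rhoy.
apply: (@cvg_pseries_bounded _ _ _ (`|c| * B)) => k.
rewrite !normrM -mulrA ler_wpM2l// -mulrA.
apply: le_trans (HB k); have b0 := ltW (bcoef_gt0 k mu0); rewrite ger0_norm//.
rewrite ler_wpM2l// exprMn ler_wpM2r// exprn_ge0//.
by rewrite ltW// (lt_trans _ y_gt1).
Qed.

Let diffs_coef (mu c : R) (g : nat -> R) : pseries_diffs (fun k => c * (bcoef mu k * g k)) =
  (fun k => (c * mu) * (bcoef (mu + 1) k * g k.+1)).
Proof.
apply/funext => k; rewrite /pseries_diffs.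
by rewrite mulrCA [k.+1%:R * _]mulrA bcoef_shift -!mulrA.
Qed.

(** Here g stands for the real or the imaginary part of the powers of x. The factor [1 *] gives the
    series the same shape [c * (bcoef mu k * g k)] as its derivatives, so that [cvg_coef] and
    [diffs_coef] apply to all of them. *)
Definition binser (g : nat -> R) (t : R) : R := limn (pseries (fun k => 1 * (bcoef lam k * g k)) t).
Definition binser' (g : nat -> R) (t : R) : R :=
  limn (pseries (fun k => 1 * lam * (bcoef (lam + 1) k * g k.+1)) t).

Let lam1_gt0 : 0 < lam + 1. Proof. by rewrite ltr_wpDr. Qed.

Definition geom_le (g : nat -> R) := forall k, `|g k| <= rho ^+ k.

Let domS g : geom_le g -> geom_le (fun k => g k.+1).
Proof.
move=> gd k; apply: le_trans (gd k.+1) _.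
by rewrite exprS ler_piMl ?exprn_ge0// ltW.
Qed.

Lemma binser_derive g t : geom_le g -> `|t| < y -> is_derive t (1 : R) (binser g) (binser' g t).
Proof.
move=> gd ty.
(* Termwise differentiation at t requires convergence of the series and of its first two formal
   derivatives at a point beyond |t|: the midpoint of |t| and y. *)
have [K tK Ky] : exists2 K, `|t| < K & K < y.
  by exists ((`|t| + y) / 2); [rewrite ltr_pdivlMr | rewrite ltr_pdivrMr]; lra.
have K0 : `|K| = K by rewrite ger0_norm// ltW// (le_lt_trans _ tK).
rewrite /binser /binser' -diffs_coef.
apply: (@pseries_snd_diffs _ _ K).
- by apply: cvg_coef => //; rewrite K0.
- by rewrite diffs_coef; apply: cvg_coef => //; [apply: domS | rewrite K0].
- rewrite !diffs_coef; apply: cvg_coef; rewrite ?K0//; last exact: (domS (domS gd)).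
  by rewrite ltr_wpDr.
- by rewrite K0.
Qed.

Lemma cvg_binser g t : geom_le g -> `|t| < y ->
  series (fun k => 1 * (bcoef lam k * g k) * t ^+ k) @ \oo --> binser g t.
Proof. by move=> gd ty; have := @cvg_coef lam 1 g t lam_gt0 gd ty; apply. Qed.

Let cvg_D g t : geom_le g -> `|t| < y ->
  series (fun k => 1 * lam * (bcoef (lam + 1) k * g k.+1) * t ^+ k) @ \oo --> binser' g t.
Proof. by move=> gd ty; have := @cvg_coef _ (1 * lam) _ t lam1_gt0 (domS gd) ty; apply. Qed.

(* One real component of the equation (1 - t x) s' = lam x s satisfied by
   s t = (1 - t x) ^ (- lam), where g and h stand for the real and imaginary parts
   of the powers of x. *)
Lemma binser_ode a c g h (t : R) : geom_le g -> geom_le h -> `|t| < y ->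
  (forall k, g k.+1 = a * g k + c * h k) ->
  binser' g t - t * (a * binser' g t + c * binser' h t) = lam * (a * binser g t + c * binser h t).
Proof.
move=> gd hd ty gS.
pose s f n := series (fun k => 1 * (bcoef lam k * f k) * t ^+ k) n : R.
pose d f n := series (fun k => 1 * lam * (bcoef (lam + 1) k * f k.+1) * t ^+ k) n : R.
(* Since multiplication by t raises degrees by one, the equation is exact on partial sums whose
   truncation ranks are staggered by one; it then passes to the limit. *)
have fin n : d g n.+1 - t * (a * d g n + c * d h n) = lam * (a * s g n.+1 + c * s h n.+1).
  elim: n => [|n IH].
    rewrite /d /s /series/= !big_nat1 !big_nil !bcoef0 !expr0 gS; ring.
  have E f k : 1 * lam * (bcoef (lam + 1) k * f k.+1) * t ^+ k =
      (lam + k%:R) * bcoef lam k * f k.+1 * t ^+ k.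
    by rewrite -bcoefS bcoef_shift mul1r !mulrA.
  have E' f k : 1 * lam * (bcoef (lam + 1) k * f k.+1) * t ^+ k =
      k.+1%:R * bcoef lam k.+1 * f k.+1 * t ^+ k.
    by rewrite bcoef_shift mul1r !mulrA.
  rewrite /d /s /series/= big_nat_recr//= [in RHS]big_nat_recr//=.
  rewrite [X in _ - _ * (_ + _ * X)]big_nat_recr//=.
  rewrite [X in _ - _ * (_ * X + _)]big_nat_recr//=.
  rewrite [X in _ = _ * (_ + _ * X)]big_nat_recr//=.
  move: IH; rewrite /d /s /series/=.
  set d1 := \sum_(0 <= k < n.+1) _.
  set d2 := \sum_(0 <= k < n) _.
  set d3 := \sum_(0 <= k < n) _.
  set s1 := \sum_(0 <= k < n.+1) _.
  set s2 := \sum_(0 <= k < n.+1) _.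
  rewrite E !E' (gS n.+1) exprS.
  move=> IH.
  transitivity (lam * (a * s1 + c * s2) +
    ((lam + n.+1%:R) * bcoef lam n.+1 * (a * g n.+1 + c * h n.+1) * (t * t ^+ n)
     - t * (a * (n.+1%:R * bcoef lam n.+1 * g n.+1 * t ^+ n) +
            c * (n.+1%:R * bcoef lam n.+1 * h n.+1 * t ^+ n)))).
    by rewrite -IH; ring.
  by ring.
have shift (u : nat -> R) l : u @ \oo --> l -> (fun n => u n.+1) @ \oo --> l.
  by move=> ul; rewrite cvg_shiftS.
have L : (fun n => d g n.+1 - t * (a * d g n + c * d h n)) @ \oo -->
    binser' g t - t * (a * binser' g t + c * binser' h t).
  apply: cvgB; first exact/shift/cvg_D.
  by apply: cvgMr; apply: cvgD; apply: cvgMr; apply: cvg_D.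
have L' : (fun n => lam * (a * s g n.+1 + c * s h n.+1)) @ \oo -->
    lam * (a * binser g t + c * binser h t).
  apply: cvgMr; apply: cvgD; apply: cvgMr; apply: shift; exact: cvg_binser.
by move: L; rewrite (funext fin) => /(cvg_unique _); apply.
Qed.

End BinomialSeries.

(** * Identification of the sum with the principal power *)

Section BinomialSeriesSum.
Variables (R : realType) (lam : R) (a b : R).
Hypotheses (lam_gt0 : 0 < lam) (ab_lt1 : a ^+ 2 + b ^+ 2 < 1).

(** For x = a + i b, [N t] is |1 - t x|^2, while [r t] and [tau t] are the modulus and the argument
    of (1 - t x)^lam. The arctangent gives the argument because 1 - t x has positive real part. *)
Let N (t : R) := (1 - t * a) ^+ 2 + (t * b) ^+ 2.
Let r (t : R) := expR (lam / 2 * ln (N t)).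
Let tau (t : R) := lam * atan ((- (t * b)) / (1 - t * a)).

Let a_lt1 : a < 1.
Proof.
rewrite ltNge; apply/negP => a1; have := sqr_ge0 b; move: ab_lt1; nra.
Qed.

Let re_gt0 (t : R) : 0 <= t <= 1 -> 0 < 1 - t * a.
Proof.
move=> /andP[t0 t1]; have [a0|a0] := leP a 0; first by nra.
by have := ler_piMl (ltW a0) t1; move: a_lt1; lra.
Qed.

Let N_gt0 (t : R) : 0 <= t <= 1 -> 0 < N t.
Proof. by move=> t01; rewrite ltr_wpDr ?sqr_ge0// exprn_gt0// re_gt0. Qed.

Let r_derive (t : R) : 0 <= t <= 1 ->
  is_derive t (1 : R) r (r t * (lam * (t * (a ^+ 2 + b ^+ 2) - a) / N t)).
Proof.
move=> t01; have Nt := N_gt0 t01.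
have dN : is_derive t (1 : R) N (2 * (t * (a ^+ 2 + b ^+ 2) - a)).
  apply: is_derive_eq; rewrite /GRing.scale/=; ring.
have dln : is_derive t (1 : R) (@ln R \o N) ((N t)^-1 * (2 * (t * (a ^+ 2 + b ^+ 2) - a))).
  exact: is_derive1_comp (is_derive1_ln Nt) dN.
have dm : is_derive t (1 : R) (fun t => lam / 2 * ln (N t))
     (lam / 2 * ((N t)^-1 * (2 * (t * (a ^+ 2 + b ^+ 2) - a)))).
  exact: (is_deriveZ _ dln).
apply: (@is_derive_eq _ _ _ _ _ _ _ _ (is_derive1_comp (f := expR) _ dm)).
rewrite -/(r t); field.
by rewrite gt_eqF.
Qed.

Let tau_derive (t : R) : 0 <= t <= 1 -> is_derive t (1 : R) tau (- (lam * b) / N t).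
Proof.
move=> t01; have Nt := N_gt0 t01; have re := re_gt0 t01.
have re0 : 1 - t * a != 0 by rewrite gt_eqF.
have dinv : is_derive t (1 : R) (fun t => (1 - t * a)^-1) (a * (1 - t * a) ^- 2).
  have dl : is_derive t (1 : R) (fun t => 1 - t * a) (- a).
    by apply: is_derive_eq; rewrite /GRing.scale/=; ring.
  apply: (@is_derive_eq _ _ _ _ _ _ _ _ (@is_deriveV _ (fun s : R => 1 - s * a) t _ _ re0 dl)).
  by rewrite /GRing.scale/=; ring.
have dq : is_derive t (1 : R) (fun t => (- (t * b)) / (1 - t * a))
    (- b / (1 - t * a) ^+ 2).
  apply: is_derive_eq; rewrite /GRing.scale/=; field.
  exact: re0.
have dat := is_derive1_comp (f := atan) (is_derive1_atan _) dq.
apply: (@is_derive_eq _ _ _ _ _ _ _ _ (is_deriveZ lam dat)).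
rewrite /GRing.scale/= /N; field.
rewrite re0 gt_eqF //=.
Qed.


Let x : R[i] := Complex a b.
Let rho := Num.sqrt (a ^+ 2 + b ^+ 2).
(** A radius strictly between 1 and 1 / |x|, so that t = 1 lies inside the interval of
    convergence. *)
Let y := 2 / (1 + rho).
Let re k := complex.Re (x ^+ k).
Let im k := complex.Im (x ^+ k).

Let rho_ge0 : 0 <= rho. Proof. exact: sqrtr_ge0. Qed.

Let rho_lt1 : rho < 1.
Proof. by rewrite -[X in _ < X]sqrtr1 ltr_sqrt. Qed.

Let y_gt1 : 1 < y.
Proof. by rewrite /y ltr_pdivlMr; move: rho_ge0 rho_lt1; lra. Qed.

Let rhoy : rho * y < 1.
Proof.
have h : 0 < 1 + rho by move: rho_ge0; lra.
by rewrite /y mulrA ltr_pdivrMr//; move: rho_lt1; lra.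
Qed.

Let reS k : re k.+1 = a * re k + (- b) * im k.
Proof. by rewrite /re /im exprS; case: (x ^+ k) => u v /=; rewrite mulNr. Qed.

Let imS k : im k.+1 = a * im k + b * re k.
Proof. by rewrite /re /im exprS; case: (x ^+ k) => u v. Qed.

Let re_le : geom_le rho re.
Proof.
move=> k; have := normc_ge_Re (x ^+ k).
by rewrite normrX normc_def -rmorphXn lecR.
Qed.

Let im_le : geom_le rho im.
Proof.
move=> k; rewrite /im.
have -> : `|complex.Im (x ^+ k)| = Num.sqrt (complex.Im (x ^+ k) ^+ 2) by rewrite sqrtr_sqr.
have : `|x ^+ k| = (rho ^+ k)%:C%C by rewrite normrX normc_def -rmorphXn.
rewrite normc_def => -[<-]; apply: ler_wsqrtr.
by rewrite lerDr sqr_ge0.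
Qed.

Let s1 := binser lam re.
Let s2 := binser lam im.
Let d1 := binser' lam re.
Let d2 := binser' lam im.

Let ty (t : R) : 0 <= t <= 1 -> `|t| < y.
Proof. by move=> /andP[t0 t1]; rewrite ger0_norm// (le_lt_trans t1). Qed.

(** The two real components of the differential equation form a linear system in the derivatives,
    with determinant [N t]; it is solved by Cramer's rule. *)
Let d1E (t : R) : 0 <= t <= 1 ->
  d1 t = lam * ((1 - t * a) * (a * s1 t - b * s2 t) - t * b * (a * s2 t + b * s1 t)) / N t.
Proof.
move=> t01; have Nt := N_gt0 t01.
have := binser_ode lam_gt0 rho_ge0 rho_lt1 y_gt1 rhoy re_le im_le (ty t01) reS.
have := binser_ode lam_gt0 rho_ge0 rho_lt1 y_gt1 rhoy im_le re_le (ty t01) imS.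
rewrite -/s1 -/s2 -/d1 -/d2 => e2 e1.
apply: (mulIf (lt0r_neq0 Nt)); rewrite divfK ?lt0r_neq0//.
have -> : d1 t * N t = (1 - t * a) * (d1 t - t * (a * d1 t + - b * d2 t))
   - t * b * (d2 t - t * (a * d2 t + b * d1 t)) by rewrite /N; ring.
by rewrite e1 e2; ring.
Qed.

Let d2E (t : R) : 0 <= t <= 1 ->
  d2 t = lam * ((1 - t * a) * (a * s2 t + b * s1 t) + t * b * (a * s1 t - b * s2 t)) / N t.
Proof.
move=> t01; have Nt := N_gt0 t01.
have := binser_ode lam_gt0 rho_ge0 rho_lt1 y_gt1 rhoy re_le im_le (ty t01) reS.
have := binser_ode lam_gt0 rho_ge0 rho_lt1 y_gt1 rhoy im_le re_le (ty t01) imS.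
rewrite -/s1 -/s2 -/d1 -/d2 => e2 e1.
apply: (mulIf (lt0r_neq0 Nt)); rewrite divfK ?lt0r_neq0//.
have -> : d2 t * N t = (1 - t * a) * (d2 t - t * (a * d2 t + b * d1 t))
   + t * b * (d1 t - t * (a * d1 t + - b * d2 t)) by rewrite /N; ring.
by rewrite e1 e2; ring.
Qed.

(** Real and imaginary parts of (1 - t x)^lam times the sum of the series. Both have derivative 0 on
    [0, 1], so the product keeps its value 1 from t = 0 to t = 1. *)
Let F1 t := r t * (s1 t * cos (tau t) - s2 t * sin (tau t)).
Let F2 t := r t * (s1 t * sin (tau t) + s2 t * cos (tau t)).

Let F_derive (t : R) : 0 <= t <= 1 ->
  is_derive t (1 : R) F1 0 /\ is_derive t (1 : R) F2 0.
Proof.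
move=> t01; have Nt0 := lt0r_neq0 (N_gt0 t01).
have dr := r_derive t01; have dtau := tau_derive t01.
have ds1 := binser_derive lam_gt0 rho_ge0 rho_lt1 y_gt1 rhoy re_le (ty t01).
have ds2 := binser_derive lam_gt0 rho_ge0 rho_lt1 y_gt1 rhoy im_le (ty t01).
have dcos := is_derive1_comp (f := cos) (is_derive_cos _) dtau.
have dsin := is_derive1_comp (f := sin) (is_derive_sin _) dtau.
rewrite -/s1 -/d1 in ds1; rewrite -/s2 -/d2 in ds2.
split.
- have d := is_deriveM dr (is_deriveB (is_deriveM ds1 dcos) (is_deriveM ds2 dsin)).
  apply: (is_derive_eq d).
  rewrite /GRing.scale/= (_ : (_ - _) t = s1 t * cos (tau t) - s2 t * sin (tau t))//.
  rewrite d1E// d2E// /N; field; exact: Nt0.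
- have d := is_deriveM dr (is_deriveD (is_deriveM ds1 dsin) (is_deriveM ds2 dcos)).
  apply: (is_derive_eq d).
  rewrite /GRing.scale/= (_ : (_ + _) t = s1 t * sin (tau t) + s2 t * cos (tau t))//.
  rewrite d1E// d2E// /N; field; exact: Nt0.
Qed.

Let cst_of_derive0 (F : R -> R) :
  (forall t : R, 0 <= t <= 1 -> is_derive t (1 : R) F 0) -> F 1 = F 0.
Proof.
move=> dF; have [t||t _] := @MVT R F (fun=> 0) 0 1 ltr01.
- by rewrite in_itv/= => /andP[? ?]; apply: dF; rewrite !ltW.
- apply: derivable_within_continuous => t; rewrite in_itv/= => t01.
  by have [] := dF t t01.
- by rewrite mul0r => /eqP; rewrite subr_eq0 => /eqP.
Qed.

Let binser0 g : binser lam g 0 = g 0%N.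
Proof.
apply: cvg_lim => //; apply/cvgrPdist_lt => e e0.
near=> n; rewrite /pseries /series/=.
have n0 : (0 < n)%N by near: n; exact: nbhs_infty_gt.
rewrite -(prednK n0) big_nat_recl// big1 ?addr0.
  by rewrite bcoef0 expr0 !mul1r mulr1 subrr normr0.
by move=> i _; rewrite expr0n/= mulr0.
Unshelve. all: by end_near.
Qed.

(** At t = 1 the product is 1; multiplying by the inverse of the rotation of angle [tau 1] isolates
    the series. *)
Let binser1 : s1 1 = (r 1)^-1 * cos (tau 1) /\ s2 1 = - ((r 1)^-1 * sin (tau 1)).
Proof.
have r0 : r 1 != 0 by rewrite gt_eqF// expR_gt0.
have e1 : F1 1 = 1.
  rewrite (cst_of_derive0 (fun t t01 => (F_derive t01).1)).
  rewrite /F1 /s1 /s2 !binser0 /r /tau /N /re /im/=.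
  by rewrite !mul0r subr0 oppr0 mul0r atan0 mulr0 ?cos0 ?sin0 expr1n expr0n/= addr0 ln1 mulr0 expR0; ring.
have e2 : F2 1 = 0.
  rewrite (cst_of_derive0 (fun t t01 => (F_derive t01).2)).
  rewrite /F2 /s1 /s2 !binser0 /r /tau /N /re /im/=.
  by rewrite !mul0r subr0 oppr0 mul0r atan0 mulr0 ?cos0 ?sin0 expr1n expr0n/= addr0 ln1 mulr0 expR0; ring.
have cs := cos2Dsin2 (tau 1).
split; apply: (mulfI r0).
- rewrite mulVKf//.
  have -> : cos (tau 1) = cos (tau 1) * F1 1 + sin (tau 1) * F2 1 by rewrite e1 e2; ring.
  transitivity (r 1 * s1 1 * (cos (tau 1) ^+ 2 + sin (tau 1) ^+ 2)); first by rewrite cs mulr1.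
  by rewrite /F1 /F2; ring.
- rewrite mulrN mulVKf//.
  have -> : - sin (tau 1) = cos (tau 1) * F2 1 - sin (tau 1) * F1 1 by rewrite e1 e2; ring.
  transitivity (r 1 * s2 1 * (cos (tau 1) ^+ 2 + sin (tau 1) ^+ 2)); first by rewrite cs mulr1.
  by rewrite /F1 /F2; ring.
Qed.

Let rE : (r 1)^-1 = complex.Re `|1 - x| `^ (- lam).
Proof.
have N1 : 0 < N 1 by rewrite N_gt0// ler01 lexx.
rewrite normc_def/= sub0r sqrrN.
have -> : (1 - a) ^+ 2 + b ^+ 2 = N 1 by rewrite /N !mul1r.
rewrite -powR12_sqrt ?ltW// -powRrM /powR gt_eqF// /r -expRN; congr expR.
by field.
Qed.

Let cpowE : cpow (1 - x : Cplx R) (- lam) = Complex (s1 1) (s2 1).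
Proof.
have [-> ->] := binser1.
rewrite /cpow -rE/= sub0r mulNr cosN sinN mulrN.
by rewrite /tau !mul1r.
Qed.

Lemma cvg_binomial_series :
  (fun n => \sum_(k < n) bcoef lam k * complex.Re (x ^+ k)) @ \oo -->
    complex.Re (cpow (1 - x : Cplx R) (- lam)) /\
  (fun n => \sum_(k < n) bcoef lam k * complex.Im (x ^+ k)) @ \oo -->
    complex.Im (cpow (1 - x : Cplx R) (- lam)).
Proof.
have h g : geom_le rho g ->
    (fun n => \sum_(k < n) bcoef lam k * g k) @ \oo --> binser lam g 1.
  move=> gle.
  have := cvg_binser lam_gt0 rho_ge0 y_gt1 rhoy gle (ty (_ : 0 <= 1 <= 1)).
  rewrite ler01 lexx => /(_ isT).
  rewrite (_ : series _ = (fun n => \sum_(k < n) bcoef lam k * g k))//.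
  apply/funext => n; by rewrite /series/= big_mkord; apply: eq_bigr => k _; rewrite expr1n mulr1 mul1r.
rewrite cpowE /=; split; exact: h.
Qed.

End BinomialSeriesSum.

(** * Uniform approximation of complex binomial series and of products *)

Section ComplexBounds.
Variable R : realType.
Local Notation C := (Cplx R).

Lemma real_of_gt0 (e : C) : 0 < e -> exists2 d : R, 0 < d & e = d%:C%C.
Proof.
by case: e => u v; rewrite ltcE/= => /andP[/eqP v0 u0]; exists u; rewrite // v0.
Qed.

Lemma norm_le_ReIm (x : C) : `|x| <= (`|complex.Re x| + `|complex.Im x|)%:C%C.
Proof.
case: x => u v; rewrite normc_def lecR/=.
rewrite -[leRHS]ger0_norm ?addr_ge0// -sqrtr_sqr ler_wsqrtr// sqrrD !real_normK ?num_real//.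
by rewrite -addrA lerD2l lerDr mulrn_wge0// mulr_ge0.
Qed.

Lemma norm_ge_Re (x : C) (e : R) : `|x| <= e%:C%C -> `|complex.Re x| <= e.
Proof. by move=> xe; rewrite -lecR; exact: le_trans (normc_ge_Re _) xe. Qed.

Lemma norm_ge_Im (x : C) (e : R) : `|x| <= e%:C%C -> `|complex.Im x| <= e.
Proof.
case: x => u v; rewrite normc_def lecR/=; apply: le_trans.
by rewrite -sqrtr_sqr ler_wsqrtr// lerDr sqr_ge0.
Qed.

Lemma cvg_dist_le (v : nat -> R) (l e : R) (N : nat) :
  v @ \oo --> l -> (forall M, (N <= M)%N -> `|v M - v N| <= e) -> `|l - v N| <= e.
Proof.
move=> vl vN; apply/ler_addgt0Pr => d d0.
have /cvgrPdist_le/(_ d d0)[M _ HM] := vl.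
have h := HM (maxn M N) (leq_maxl _ _).
rewrite (_ : l - v N = (l - v (maxn M N)) + (v (maxn M N) - v N)); last by ring.
by apply: le_trans (ler_normD _ _) _; rewrite addrC lerD// vN// leq_maxr.
Qed.

Definition cbcoef (lam : R) k : C := (bcoef lam k)%:C%C.

Lemma cbcoef_gt0 lam k : 0 < lam -> 0 < cbcoef lam k.
Proof. by move=> ?; rewrite ltcR bcoef_gt0. Qed.

Definition bsum lam (x : C) N := \sum_(k < N) cbcoef lam k * x ^+ k.

Lemma Re_bsum lam x N :
  complex.Re (bsum lam x N) = \sum_(k < N) bcoef lam k * complex.Re (x ^+ k).
Proof.
rewrite /bsum raddf_sum; apply: eq_bigr => k _ /=.
by case: (x ^+ k) => u v /=; rewrite mul0r subr0.
Qed.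

Lemma Im_bsum lam x N :
  complex.Im (bsum lam x N) = \sum_(k < N) bcoef lam k * complex.Im (x ^+ k).
Proof.
rewrite /bsum raddf_sum; apply: eq_bigr => k _ /=.
by case: (x ^+ k) => u v /=; rewrite mul0r addr0.
Qed.

Lemma cvg_bsum lam (x : C) : 0 < lam -> `|x| < 1 ->
  (fun N => complex.Re (bsum lam x N)) @ \oo --> complex.Re (cpow (1 - x) (- lam)) /\
  (fun N => complex.Im (bsum lam x N)) @ \oo --> complex.Im (cpow (1 - x) (- lam)).
Proof.
case: x => a b lam0; rewrite normc_def ltcR/= => ab1.
have {}ab1 : a ^+ 2 + b ^+ 2 < 1.
  by move: ab1; rewrite -[X in _ < X]sqrtr1 ltr_sqrt.
have [h1 h2] := cvg_binomial_series lam0 ab1.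
by rewrite (funext (Re_bsum _ _)) (funext (Im_bsum _ _)).
Qed.

Lemma bsum_uniform lam (r e : C) : 0 < lam -> 0 <= r < 1 -> 0 < e ->
  exists N0, forall N, (N0 <= N)%N -> forall x : C, `|x| <= r ->
    `|cpow (1 - x) (- lam) - bsum lam x N| <= e.
Proof.
move=> lam0 /andP[r0 r1] /real_of_gt0[d d0 ->{e}].
have nr : `|r| < 1 by rewrite ger0_norm.
have [cr _] := cvg_bsum lam0 nr.
have /cvgrPdist_le/(_ (d / 4)) := cr; rewrite divr_gt0// => /(_ isT)[N0 _ HN0].
exists N0 => N N0N x xr.
have x1 : `|x| < 1 by apply: le_lt_trans xr r1.
(* The coefficients being positive, the tail at x is dominated by the tail at the real point r. The
   rate d / 4 at r bounds tails by d / 2, and the real and imaginary parts add up to d. *)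
have tail M : (N <= M)%N -> `|bsum lam x M - bsum lam x N| <= (d / 2)%:C%C.
  move=> NM; apply: (@le_trans _ _ (`|bsum lam r M - bsum lam r N|)).
    have split y : bsum lam y M - bsum lam y N = \sum_(N <= k < M) cbcoef lam k * y ^+ k.
      by rewrite /bsum -!(big_mkord xpredT (fun k => cbcoef lam k * y ^+ k)) (big_cat_nat _ NM)//= addrAC subrr add0r.
    rewrite !split [leRHS]ger0_norm; last first.
      by apply: sumr_ge0 => k _; rewrite mulr_ge0 ?exprn_ge0// ltW// cbcoef_gt0.
    apply: le_trans (ler_norm_sum _ _ _) _; apply: ler_sum => k _.
    rewrite normrM normrX ger0_norm ?(ltW (cbcoef_gt0 _ _))//.
    by rewrite ler_wpM2l ?(ltW (cbcoef_gt0 _ _))// lerXn2r ?nnegrE.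
  have rr k : complex.Im (bsum lam r k) = 0.
    move: r0; rewrite /bsum lecE/= => /andP[/eqP i0 _].
    rewrite raddf_sum big1// => j _ /=.
    have -> : r = (complex.Re r)%:C%C by case: (r) i0 => u v /= ->.
    by rewrite -rmorphXn/= mulr0 mul0r addr0.
  apply: le_trans (norm_le_ReIm _) _; rewrite lecR !raddfB/= !rr subrr normr0 addr0.
  have := HN0 M (leq_trans N0N NM); have := HN0 N N0N => /=.
  rewrite !ler_norml => /andP[? ?] /andP[? ?]; apply/andP; split; lra.
have [cre cim] := cvg_bsum lam0 x1.
apply: le_trans (norm_le_ReIm _) _; rewrite lecR !raddfB/=.
rewrite [leRHS](_ : d = d / 2 + d / 2); last by field.
apply: lerD.
- by apply: (cvg_dist_le cre) => M /tail/norm_ge_Re; rewrite raddfB.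
- by apply: (cvg_dist_le cim) => M /tail/norm_ge_Im; rewrite raddfB.
Qed.

(** Telescoping: the factors are exchanged one at a time, the others staying bounded by B. *)
Lemma prod_dist (I : Type) (s : seq I) (a b : I -> C) (B d : C) : 1 <= B ->
  (forall i, `|a i| <= B) -> (forall i, `|b i| <= B) -> (forall i, `|a i - b i| <= d) ->
  `|\prod_(i <- s) a i - \prod_(i <- s) b i| <= (size s)%:R * (B ^+ size s * d).
Proof.
move=> B1 aB bB abd; have B0 : 0 <= B by apply: le_trans B1.
have prodB (c : I -> C) t : (forall i, `|c i| <= B) -> `|\prod_(i <- t) c i| <= B ^+ size t.
  move=> cB; elim: t => [|i t IH]; first by rewrite big_nil normr1.
  by rewrite big_cons normrM exprS ler_pM.
elim: s => [|i s IH]; first by rewrite !big_nil subrr normr0 mul0r.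
have d0 : 0 <= d by apply: le_trans (abd i).
rewrite !big_cons /=.
rewrite (_ : _ - _ = a i * (\prod_(i <- s) a i - \prod_(i <- s) b i) +
   (a i - b i) * \prod_(i <- s) b i); last by ring.
apply: le_trans (ler_normD _ _) _; rewrite !normrM -natr1 mulrDl mul1r.
apply: lerD.
  by rewrite exprS -mulrA mulrCA ler_pM.
rewrite mulrC ler_pM//; apply: le_trans (prodB _ _ bB) _.
by rewrite exprS ler_peMl ?exprn_ge0.
Qed.

End ComplexBounds.

(** * Hilbert spaces of functions *)

Section HilbertFunctionSpace.
Variables (R : realType) (n : nat).
Local Notation C := (Cplx R).
Local Notation F := (polydisc R n -> C).
Variables (A : set F) (ip : F -> F -> C).
Hypothesis hA : is_hilbert_function_space A ip.
Implicit Types (f g h : F) (u : nat -> F) (a : C).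

Lemma hfs_scale a f : A f -> A (fun z => a * f z).
Proof.
move=> Af; rewrite (_ : (fun _ => _) = (fun z => a * f z + 0)).
  by apply: (hfs_lin hA) => //; exact: hfs_zero hA.
by apply/funext => z; rewrite addr0.
Qed.

Lemma hfs_sub f g : A f -> A g -> A (fun z => f z - g z).
Proof.
move=> Af Ag; rewrite (_ : (fun _ => _) = (fun z => -1 * g z + f z)).
  exact: (hfs_lin hA).
by apply/funext => z; rewrite mulN1r addrC.
Qed.

Lemma hfs_sum (I : Type) (s : seq I) (c : I -> C) (f : I -> F) :
  (forall i, A (f i)) -> A (fun z => \sum_(i <- s) c i * f i z).
Proof.
move=> Af; elim: s => [|i s IH].
  rewrite (_ : (fun _ => _) = (fun=> 0)); first exact: hfs_zero hA.
  by apply/funext => z; rewrite big_nil.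
rewrite (_ : (fun _ => _) = (fun z => c i * f i z + \sum_(i <- s) c i * f i z)).
  exact: (hfs_lin hA).
by apply/funext => z; rewrite big_cons.
Qed.

Lemma ip0l h : A h -> ip (fun=> 0) h = 0.
Proof.
move=> Ah; have A0 := hfs_zero hA.
have := hfs_ip_lin hA 1 A0 A0 Ah.
rewrite (_ : (fun _ => _) = (fun=> 0)); last by apply/funext => z; rewrite mulr0 addr0.
by rewrite mul1r => /eqP; rewrite -subr_eq0 opprD addrA subrr add0r oppr_eq0 => /eqP.
Qed.

Lemma ip_scalel a f h : A f -> A h -> ip (fun z => a * f z) h = a * ip f h.
Proof.
move=> Af Ah; have := hfs_ip_lin hA a Af (hfs_zero hA) Ah.
rewrite ip0l// addr0 => <-; congr ip; apply/funext => z; by rewrite addr0.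
Qed.

Lemma ip_addl f g h : A f -> A g -> A h ->
  ip (fun z => f z + g z) h = ip f h + ip g h.
Proof.
move=> Af Ag Ah; have := hfs_ip_lin hA 1 Af Ag Ah.
by rewrite mul1r => <-; congr ip; apply/funext => z; rewrite mul1r.
Qed.

Lemma ip_subl f g h : A f -> A g -> A h ->
  ip (fun z => f z - g z) h = ip f h - ip g h.
Proof.
move=> Af Ag Ah; have := hfs_ip_lin hA (-1) Ag Af Ah.
by rewrite mulN1r addrC => <-; congr ip; apply/funext => z; rewrite mulN1r addrC.
Qed.

Lemma ip_suml (I : Type) (s : seq I) (c : I -> C) (f : I -> F) h :
  (forall i, A (f i)) -> A h ->
  ip (fun z => \sum_(i <- s) c i * f i z) h = \sum_(i <- s) c i * ip (f i) h.
Proof.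
move=> Af Ah; elim: s => [|i s IH].
  rewrite big_nil; transitivity (ip (fun=> 0) h); last exact: ip0l.
  by congr ip; apply/funext => z; rewrite big_nil.
rewrite big_cons -IH -(hfs_ip_lin hA)//; last exact: hfs_sum.
by congr ip; apply/funext => z; rewrite big_cons.
Qed.

Lemma ip_subr f g h : A f -> A g -> A h ->
  ip h (fun z => f z - g z) = ip h f - ip h g.
Proof.
move=> Af Ag Ah; rewrite (hfs_ip_conj hA (hfs_sub Af Ag) Ah) ip_subl// rmorphB.
by rewrite /= -!(hfs_ip_conj hA).
Qed.

Lemma ip_scaler a f h : A f -> A h -> ip h (fun z => a * f z) = a^* * ip h f.
Proof.
move=> Af Ah; rewrite (hfs_ip_conj hA (hfs_scale a Af) Ah) ip_scalel// rmorphM.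
by rewrite /= -!(hfs_ip_conj hA).
Qed.

Lemma ip_sumr (I : Type) (s : seq I) (c : I -> C) (f : I -> F) h :
  (forall i, A (f i)) -> A h ->
  ip h (fun z => \sum_(i <- s) c i * f i z) = \sum_(i <- s) (c i)^* * ip h (f i).
Proof.
move=> Af Ah; rewrite (hfs_ip_conj hA (hfs_sum _ _ Af) Ah) ip_suml// rmorph_sum/=.
by apply: eq_bigr => i _; rewrite rmorphM /= -(hfs_ip_conj hA).
Qed.

Lemma ip_sub_self f g : A f -> A g ->
  ip (fun z => f z - g z) (fun z => f z - g z) = ip f f - ip f g - ip g f + ip g g.
Proof.
move=> Af Ag; have Afg := hfs_sub Af Ag.
by rewrite ip_subl// !ip_subr// opprB addrA addrAC -!addrA; congr (_ + _); ring.
Qed.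

Lemma ip_sub_selfC f g : A f -> A g ->
  ip (fun z => f z - g z) (fun z => f z - g z) =
  ip (fun z => g z - f z) (fun z => g z - f z).
Proof. by move=> Af Ag; rewrite !ip_sub_self//; ring. Qed.

Lemma cauchy_schwarz f g : A f -> A g -> `|ip f g| ^+ 2 <= ip f f * ip g g.
Proof.
move=> Af Ag; have gg := hfs_ip_ge0 hA Ag.
have [g0|g0] := eqVneq (ip g g) 0.
  rewrite (hfs_ip_def hA Ag g0) (hfs_ip_conj hA (hfs_zero hA) Af) !ip0l//.
    by rewrite conjC0 normr0 expr0n/= mulr0.
  exact: hfs_zero hA.
have gp : 0 < ip g g by rewrite lt0r g0.
pose a := ip f g / ip g g.
have := hfs_ip_ge0 hA (hfs_sub Af (hfs_scale a Ag)).
rewrite ip_sub_self ?(ip_scalel, ip_scaler)//; try exact: hfs_scale.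
rewrite (hfs_ip_conj hA Af Ag) /a rmorphM fmorphV/=.
rewrite (conj_Creal (ger0_real gg)) normCK => h.
rewrite -subr_ge0 (_ : _ - _ = ip g g * (ip f f - (ip f g)^* / ip g g * ip f g -
  ip f g / ip g g * (ip f g)^* +
  ip f g / ip g g * ((ip f g)^* / ip g g * ip g g))); last by field.
exact: mulr_ge0.
Qed.

(** Norm convergence, expressed by squared norms as nonnegative complex numbers to avoid square
    roots. *)
Definition hcvg u f :=
  (fun k => ip (fun z => u k z - f z) (fun z => u k z - f z)) @ \oo --> (0 : C).

Lemma hcvgP u f : (forall k, A (u k)) -> A f ->
  hcvg u f <-> forall e : C, 0 < e -> exists N, forall k, (N <= k)%N ->
    ip (fun z => u k z - f z) (fun z => u k z - f z) <= e.
Proof.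
move=> Au Af; have p k := hfs_ip_ge0 hA (hfs_sub (Au k) Af).
split=> [/cvgrPdist_le uf e /uf[N _ HN]|uf].
  exists N => k /HN /=; by rewrite sub0r normrN ger0_norm.
apply/cvgrPdist_le => e /uf[N HN]; exists N => // k /HN /=.
by rewrite sub0r normrN ger0_norm.
Qed.

Lemma hcvg_ip u f g : (forall k, A (u k)) -> A f -> A g -> hcvg u f ->
  (fun k => ip (u k) g) @ \oo --> ip f g.
Proof.
move=> Au Af Ag /(hcvgP Au Af) uf; apply/cvgrPdist_le => e e0.
have gg := hfs_ip_ge0 hA Ag.
have g1 : 0 < ip g g + 1 by rewrite ltr_wpDl.
have [|N HN] := uf (e ^+ 2 / (ip g g + 1)); first by rewrite divr_gt0// exprn_gt0.
exists N => // k /HN /= h.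
rewrite distrC -ip_subl// -(ler_pXn2r (ltn0Sn 1)) ?nnegrE ?(ltW e0)//.
apply: le_trans (cauchy_schwarz (hfs_sub (Au k) Af) Ag) _.
rewrite ler_pdivlMr// in h; apply: le_trans h.
by rewrite ler_wpM2l ?lerDl// (hfs_ip_ge0 hA)//; exact: hfs_sub.
Qed.

Lemma hcvg_ip_self u f : (forall k, A (u k)) -> A f -> hcvg u f ->
  (fun k => ip (u k) (u k)) @ \oo --> ip f f.
Proof.
move=> Au Af uf.
have c1 := hcvg_ip Au Af Af uf.
have c2 : (fun k => (ip (u k) f)^*) @ \oo --> ip f f.
  apply/cvgrPdist_le => e e0; have /cvgrPdist_le/(_ e e0)[N _ HN] := c1.
  exists N => // k /HN /= h; rewrite -(conj_Creal (ger0_real (hfs_ip_ge0 hA Af))).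
  by rewrite -rmorphB norm_conjC.
have E : (fun k => ip (u k) (u k)) =
    (fun k => ip (fun z => u k z - f z) (fun z => u k z - f z) +
              (ip (u k) f + (ip (u k) f)^* - ip f f)).
  apply/funext => k; rewrite (ip_sub_self (Au k) Af) (hfs_ip_conj hA (Au k) Af).
  by ring.
rewrite E [X in _ --> X](_ : _ = 0 + (ip f f + ip f f - ip f f)); last by rewrite add0r addrK.
exact: cvgD uf (cvgB (cvgD c1 c2) (cvg_cst (ip f f))).
Qed.

(** Transfers completeness from the real norm [hnorm] to complex squared norms. The bound (d / 2)^2
    turns a weak inequality into the strict one required by [hfs_complete]. *)
Lemma hcvg_cauchy u :
  (forall k, A (u k)) ->
  (forall e : C, 0 < e -> exists N, forall k m, (N <= k)%N -> (N <= m)%N ->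
    ip (fun z => u k z - u m z) (fun z => u k z - u m z) <= e) ->
  exists2 f, A f & hcvg u f.
Proof.
move=> Au cau.
have hn f (d : R) : A f -> 0 < d -> ip f f <= ((d / 2) ^+ 2)%:C%C -> hnorm ip f < d.
  move=> Af d0; have := hfs_ip_ge0 hA Af; rewrite /hnorm !lecE/= => /andP[_ p0] /andP[_ p1].
  rewrite -[ltRHS]ger0_norm ?(ltW d0)// -sqrtr_sqr ltr_sqrt ?exprn_gt0//.
  by apply: le_lt_trans p1 _; rewrite ltr_pXn2r ?nnegrE//; lra.
have [|f Af uf] := hfs_complete hA Au.
  move=> d d0; have [|N HN] := cau ((d / 2) ^+ 2)%:C%C.
    by rewrite ltcR exprn_gt0// divr_gt0.
  by exists N => k m kN mN; apply: hn => //; [exact: hfs_sub|exact: HN].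
exists f => //; apply/(hcvgP Au Af) => e /real_of_gt0[d d0 ->{e}].
have [|N HN] := uf (Num.sqrt d); first by rewrite sqrtr_gt0.
exists N => k /HN; rewrite /hnorm.
have := hfs_ip_ge0 hA (hfs_sub (Au k) Af); set q := ip _ _.
case: q => v w; rewrite !lecE/= => /andP[/eqP -> v0]; rewrite eqxx ltr_sqrt//.
exact: ltW.
Qed.

Variable K : polydisc R n -> polydisc R n -> C.
Hypothesis hK : has_reproducing_kernel A ip K.

(** Evaluation at w is the inner product with the kernel at w, hence continuous for the norm. *)
Lemma hcvg_eval u f w : (forall k, A (u k)) -> A f -> hcvg u f ->
  (fun k => u k w) @ \oo --> f w.
Proof.
move=> Au Af uf; have [AK repr] := hK w; rewrite (repr f Af).
rewrite (funext (fun k => repr (u k) (Au k))).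
exact: hcvg_ip.
Qed.

End HilbertFunctionSpace.

(** * Monomials in the Bergman space *)

Section RootsOfUnity.
Variable F : closedFieldType.

(** X^N - 1 is separable and so has N distinct roots; a set of N distinct N-th roots of unity
    contains a primitive one. *)
Lemma prim_root_exists (N : nat) : (0 < N)%N -> N%:R != 0 :> F ->
  exists z : F, N.-primitive_root z.
Proof.
move=> N0 NF; pose p : {poly F} := 'X^N - 1.
have [s ps] := closed_field_poly_normal p.
rewrite (monicP (monicXnsubC 1 N0)) scale1r in ps.
have sz : size s = N.
  by apply: succn_inj; rewrite -(size_prod_XsubC s id) -ps size_XnsubC.
have us : all N.-unity_root s.
  by apply/allP => z zs; rewrite /root_of_unity -/p ps root_prod_XsubC.
have uniqs : uniq s.
  rewrite -separable.separable_prod_XsubC -ps; exact: cyclotomic.separable_Xn_sub_1.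
have /hasP[z _ zN] := cyclic.has_prim_root N0 us uniqs (eq_leq (esym sz)).
by exists z.
Qed.

Lemma sum_prim_root (N : nat) (z : F) (a k : nat) : N.-primitive_root z ->
  (a < N)%N -> (k < N)%N ->
  \sum_(t < N) z ^+ t ^+ a * (z ^+ t ^+ k)^-1 = (a == k)%:R * N%:R.
Proof.
move=> zN aN kN; have z0 : z != 0.
  by rewrite (prim_root_eq0 zN); apply: contraTneq aN => ->.
pose q := z ^+ a * (z ^+ k)^-1.
have E : \sum_(t < N) z ^+ t ^+ a * (z ^+ t ^+ k)^-1 = \sum_(t < N) q ^+ t.
  by apply: eq_bigr => t _; rewrite /q exprMn exprVn -!exprM ![(t * _)%N]mulnC.
rewrite {}E; have [ak|ak] := eqVneq a k.
  rewrite /q ak divff ?expf_neq0//; under eq_bigr do rewrite expr1n.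
  by rewrite sumr_const card_ord mul1r.
have q1 : q - 1 != 0.
  rewrite subr_eq0; apply: contra ak => /eqP q1.
  have /eqP : z ^+ a = z ^+ k.
    by rewrite -[RHS]mul1r -q1 /q divfK ?expf_neq0.
  by rewrite (eq_prim_root_expr zN) !modn_small.
have qN : q ^+ N = 1.
  by rewrite /q exprMn exprVn -!exprM ![(_ * N)%N]mulnC !exprM (prim_expr_order zN) !expr1n divff ?oner_eq0.
by apply: (mulfI q1); rewrite mul0r mulr0 -subrX1 qN subrr.
Qed.

End RootsOfUnity.

Section BergmanMonomials.
Variables (R : realType) (n : nat) (lam : R).
Local Notation C := (Cplx R).
Local Notation D := (polydisc R n).

Hypothesis lam_gt0 : 0 < lam.
Local Notation coord := Defs.coord.
Implicit Types (z w : D) (m : 'I_n -> nat).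

Lemma coord_lt1 z j : `|coord z j| < 1.
Proof. by have /forallP := valP z; apply. Qed.

Lemma norm_coordM (r : C) z w j : `|coord w j| <= r -> `|coord z j * (coord w j)^*| <= r.
Proof.
move=> wr; rewrite normrM norm_conjC (le_trans _ wr)//.
by rewrite ler_piMl// ltW// coord_lt1.
Qed.

Lemma bergman_kernel_approx (r e : C) : 0 <= r < 1 -> 0 < e ->
  exists N0, forall N, (N0 <= N)%N -> forall z w, (forall j, `|coord w j| <= r) ->
    `|bergman_kernel lam z w - \prod_(j < n) bsum lam (coord z j * (coord w j)^*) N| <= e.
Proof.
move=> r01 e0.
have [N1 HN1] := bsum_uniform lam_gt0 r01 ltr01.
have /andP[r0 r1] := r01.
(* The factors of the kernel are within 1 of a partial sum dominated by its value at r, hence at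
   most B - 1. The remaining unit covers their approximants, which are within d <= 1 of them. *)
pose B := bsum lam r N1 + 2.
have bs0 : 0 <= bsum lam r N1.
  by apply: sumr_ge0 => k _; rewrite mulr_ge0 ?exprn_ge0// ltW// cbcoef_gt0.
have B1 : 1 <= B by rewrite /B -[2]/(1 + 1) addrA lerDr addr_ge0.
have Bn : 0 < (n.+1)%:R * B ^+ n by rewrite mulr_gt0// exprn_gt0// (lt_le_trans ltr01).
(* The factor [n.+1] rather than [n] keeps the denominator nonzero when n = 0. *)
pose d := Num.min 1 (e / ((n.+1)%:R * B ^+ n)).
have er : e / (n.+1%:R * B ^+ n) \is Num.real by rewrite ger0_real// ltW// divr_gt0.
have [d0 d1 de] : [/\ 0 < d, d <= 1 & d <= e / (n.+1%:R * B ^+ n)].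
  rewrite /d; case: (real_leP (@real1 C) er) => h.
    by split.
  by split; rewrite ?divr_gt0// ltW.
have [N0 HN0] := bsum_uniform lam_gt0 r01 d0.
exists N0 => N N0N z w wr.
have xr j := norm_coordM z (wr j).
have kB j : `|cpow (1 - coord z j * (coord w j)^*) (- lam)| <= B - 1.
  have := HN1 N1 (leqnn _) _ (xr j); set k := cpow _ _; set s := bsum _ _ _ => h.
  rewrite -[k](subrK s); apply: le_trans (ler_normD _ _) _.
  rewrite /B [leRHS](_ : _ = 1 + bsum lam r N1); last by ring.
  apply: lerD => //; apply: le_trans (ler_norm_sum _ _ _) _; apply: ler_sum => i _.
  rewrite normrM normrX ger0_norm ?(ltW (cbcoef_gt0 _ _))//.
  by rewrite ler_wpM2l ?(ltW (cbcoef_gt0 _ _))// lerXn2r ?nnegrE.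
have close j := HN0 N N0N _ (xr j).
apply: (@le_trans _ _ (n%:R * (B ^+ n * d))).
  have := @prod_dist R _ (index_enum 'I_n) (fun j => cpow (1 - coord z j * (coord w j)^*) (- lam))
    (fun j => bsum lam (coord z j * (coord w j)^*) N) B d B1 _ _ close.
  rewrite (_ : size (index_enum 'I_n) = n); last by rewrite /index_enum -enumT size_enum_ord.
  apply => j.
    by apply: le_trans (kB j) _; rewrite lerBlDr lerDl.
  have := close j; have := kB j; set k := cpow _ _; set s := bsum _ _ _ => h1 h2.
  rewrite -[s](subrK k); apply: le_trans (ler_normD _ _) _.
  rewrite [leRHS](_ : B = 1 + (B - 1)); last by ring.
  by apply: lerD => //; rewrite distrC; apply: le_trans d1.
rewrite ler_pdivlMr// in de; apply: le_trans de.
rewrite mulrA mulrC ler_wpM2l ?(ltW d0)// ler_wpM2r ?ler_nat//.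
by rewrite exprn_ge0// (le_trans ler01).
Qed.

Definition mon m : D -> C := fun z => \prod_(j < n) coord z j ^+ m j.

(** The coefficient of z^m conj(w)^m in the kernel, which turns out to be the inverse of the squared
    norm of z^m. *)
Definition mon_weight m : C := \prod_(j < n) cbcoef lam (m j).

Lemma mon_weight_gt0 m : 0 < mon_weight m.
Proof. by apply: prodr_gt0 => j _; rewrite cbcoef_gt0. Qed.

Variables (A : set (D -> C)) (ip : (D -> C) -> (D -> C) -> C).
Hypothesis hB : is_bergman_space lam A ip.

Let hA : is_hilbert_function_space A ip. Proof. by case: hB. Qed.
Let hK : has_reproducing_kernel A ip (bergman_kernel lam). Proof. by case: hB. Qed.

(** * Discrete Fourier averages of the kernel over a torus of radius 1/2 *)

Section Fourier.
Variables (N : nat) (zeta : C).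
Hypotheses (N_gt0 : (0 < N)%N) (zetaP : N.-primitive_root zeta).

Let r : C := 2^-1.

Let norm_zeta k : `|zeta ^+ k| = 1.
Proof.
have /eqP : `|zeta| ^+ N = 1 by rewrite -normrX (prim_expr_order zetaP) normr1.
by rewrite pexpr_eq1// normrX => /eqP ->; rewrite expr1n.
Qed.

Let conj_zeta k : (zeta ^+ k)^* = (zeta ^+ k)^-1.
Proof. by rewrite invC_norm norm_zeta expr1n invr1 mul1r. Qed.

Lemma torus_subproof (t : {ffun 'I_n -> 'I_N}) :
  in_polydisc (\row_j (r * zeta ^+ t j)).
Proof.
apply/forallP => j; rewrite mxE normrM norm_zeta mulr1 ger0_norm ?invr_ge0//.
by rewrite invf_lt1// ltrDl.
Qed.

Definition torus_pt (t : {ffun 'I_n -> 'I_N}) : D :=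
  exist (fun x : 'rV[C]_n => in_polydisc x) _ (torus_subproof t).

Lemma coord_torus t j : coord (torus_pt t) j = r * zeta ^+ t j.
Proof. by rewrite /coord mxE. Qed.

Definition phase m (t : {ffun 'I_n -> 'I_N}) : C := \prod_(j < n) (zeta ^+ t j) ^+ m j.

(** A discrete Fourier coefficient of the kernel in its second variable. Being a finite combination
    of kernels, it lies in the space. *)
Definition fourier m : D -> C := fun z =>
  \sum_t (N%:R ^- n * phase m t) * bergman_kernel lam z (torus_pt t).

Lemma fourier_in m : A (fourier m).
Proof. by apply: (hfs_sum hA) => t; have [] := hK (torus_pt t). Qed.

Lemma ip_fourier f m : A f ->
  ip f (fourier m) = \sum_t (N%:R ^- n * (phase m t)^*) * f (torus_pt t).
Proof.
move=> Af; rewrite (ip_sumr hA)//; last by move=> t; have [] := hK (torus_pt t).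
apply: eq_bigr => t _; have [_ <-//] := hK (torus_pt t).
by rewrite rmorphM fmorphV rmorphXn/= conjC_nat.
Qed.

Let NC : N%:R != 0 :> C. Proof. by rewrite pnatr_eq0 -lt0n. Qed.

Let average_prod (g : 'I_n -> 'I_N -> C) :
  \sum_(t : {ffun 'I_n -> 'I_N}) N%:R ^- n * \prod_j g j (t j) =
  \prod_j (N%:R^-1 * \sum_i g j i).
Proof.
rewrite -mulr_sumr -bigA_distr_bigA big_split/= prodr_const card_ord.
by rewrite -exprVn.
Qed.

Let phase_norm m t : `|phase m t| = 1.
Proof. by rewrite normr_prod big1// => j _; rewrite normrX norm_zeta expr1n. Qed.

Let average_le (u : {ffun 'I_n -> 'I_N} -> C) (p : {ffun 'I_n -> 'I_N} -> C) e :
  (forall t, `|p t| = 1) -> (forall t, `|u t| <= e) ->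
  `|\sum_t (N%:R ^- n * p t) * u t| <= e.
Proof.
move=> p1 ue; apply: le_trans (ler_norm_sum _ _ _) _.
apply: (@le_trans _ _ (\sum_(t : {ffun 'I_n -> 'I_N}) N%:R ^- n * e)).
  apply: ler_sum => t _; rewrite !normrM p1 mulr1 normfV normrX normr_nat.
  by rewrite ler_wpM2l// invr_ge0 exprn_ge0.
rewrite sumr_const card_ffun !card_ord -[_ *+ (N ^ n)]mulr_natl natrX mulrA divff ?mul1r//.
exact: expf_neq0.
Qed.

(** The average is exact on the kernel truncated at order N: with N nodes and exponents below N
    there is no aliasing, so orthogonality of roots of unity leaves the term of exponent m alone.
    Averaging does not increase the truncation error. *)
Lemma fourier_approx m e :
  (forall j, m j < N)%N ->
  (forall z w, (forall j, `|coord w j| <= r) ->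
    `|bergman_kernel lam z w - \prod_(j < n) bsum lam (coord z j * (coord w j)^*) N| <= e) ->
  forall z, `|fourier m z - \prod_(j < n) (cbcoef lam (m j) * (r * coord z j) ^+ m j)| <= e.
Proof.
move=> mN approx z.
pose P t := \prod_(j < n) bsum lam (coord z j * (coord (torus_pt t) j)^*) N.
have -> : \prod_(j < n) (cbcoef lam (m j) * (r * coord z j) ^+ m j) =
    \sum_t (N%:R ^- n * phase m t) * P t.
  under [RHS]eq_bigr => t _.
    rewrite -mulrA /phase /P -big_split/=.
    under eq_bigr => j _ do rewrite coord_torus.
    over.
  rewrite (average_prod (fun j i => (zeta ^+ i) ^+ m j * bsum lam (coord z j * (r * zeta ^+ i)^*) N)).
  apply: eq_bigr => j _.
  have -> : \sum_(i < N) (zeta ^+ i) ^+ m j * bsum lam (coord z j * (r * zeta ^+ i)^*) N =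
     \sum_(k < N) cbcoef lam k * (r * coord z j) ^+ k *
        \sum_(i < N) zeta ^+ i ^+ m j * (zeta ^+ i ^+ k)^-1.
    under [RHS]eq_bigr => k _ do rewrite mulr_sumr.
    rewrite exchange_big/=; apply: eq_bigr => i _.
    rewrite /bsum mulr_sumr; apply: eq_bigr => k _.
    rewrite rmorphM /= conj_zeta (conj_Creal (ger0_real _)) ?invr_ge0//.
    by rewrite !exprMn !exprVn; ring.
  under eq_bigr => k _ do rewrite (sum_prim_root zetaP (mN j) (ltn_ord k)).
  rewrite (bigD1 (Ordinal (mN j)))//= big1 => [|k /negPf kj].
    by rewrite eqxx mul1r addr0 [RHS]mulrCA mulVf ?mulr1.
  by rewrite eq_sym -[_ == _]/(k == Ordinal (mN j)) kj mul0r mulr0.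
rewrite /fourier -sumrB.
under eq_bigr => t _ do rewrite -mulrBr.
apply: average_le => [t|t]; first exact: phase_norm.
apply: approx => j.
by rewrite coord_torus normrM norm_zeta mulr1 ger0_norm ?invr_ge0.
Qed.

(** By the reproducing property the inner product is an average of values of f on the torus;
    replacing f by the monomial costs at most e, and the average of a monomial is computed
    exactly. *)
Lemma ip_fourier_approx f m m' (c : C) e : A f ->
  (forall j, m j < N)%N -> (forall j, m' j < N)%N ->
  (forall z, `|f z - c * mon m' z| <= e) ->
  `|ip f (fourier m) - [forall j, m j == m' j]%:R * (c * \prod_(j < n) r ^+ m j)| <= e.
Proof.
move=> Af mN m'N approx.
have -> : [forall j, m j == m' j]%:R * (c * \prod_(j < n) r ^+ m j) =
    \sum_t (N%:R ^- n * (phase m t)^*) * (c * mon m' (torus_pt t)).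
  under [RHS]eq_bigr => t _.
    rewrite mulrCA -mulrA /phase /mon rmorph_prod/= -big_split/=.
    under eq_bigr => j _ do rewrite coord_torus.
    over.
  rewrite -mulr_sumr (average_prod (fun j i => ((zeta ^+ i) ^+ m j)^* * (r * zeta ^+ i) ^+ m' j)).
  have E j : N%:R^-1 * \sum_(i < N) ((zeta ^+ i) ^+ m j)^* * (r * zeta ^+ i) ^+ m' j =
     (m j == m' j)%:R * r ^+ m j.
    under eq_bigr => i _.
      rewrite -exprM conj_zeta exprMn exprM.
      rewrite (_ : _ * _ = r ^+ m' j * (zeta ^+ i ^+ m' j * (zeta ^+ i ^+ m j)^-1)); last by ring.
      over.
    rewrite -mulr_sumr (sum_prim_root zetaP (m'N j) (mN j)) eq_sym.
    have [->|_] := eqVneq (m j) (m' j); last by rewrite !mul0r !mulr0.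
    by rewrite !mul1r mulrCA mulVf// mulr1.
  rewrite (eq_bigr _ (fun j _ => E j)) big_split/= mulrCA; congr (_ * (_ * _)).
  have [/forallP h|] := boolP [forall j, m j == m' j].
    by rewrite big1// => j _; rewrite (h j).
  by rewrite negb_forall => /existsP[j /negPf jm]; rewrite (bigD1 j)//= jm mul0r.
rewrite ip_fourier// -sumrB.
under eq_bigr => t _ do rewrite -mulrBr.
apply: average_le => [t|t]; first by rewrite norm_conjC phase_norm.
exact: approx.
Qed.

End Fourier.

End BergmanMonomials.

Lemma cvg_approx_unique (K : numFieldType) (v : nat -> K) (l l' : K) :
  v @ \oo --> l ->
  (forall e, 0 < e -> exists N0, forall k, (N0 <= k)%N -> `|v k - l'| <= e) -> l = l'.
Proof.
move=> vl vl'; apply: (@cvg_unique _ (@norm_hausdorff K K) _ _ _ _ vl).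
apply/cvgrPdist_le => e /vl'[N HN]; exists N => // k /= kN.
by rewrite distrC HN.
Qed.

(** * Monomials as norm limits of the Fourier averages *)

Section BergmanPolynomials.
Variables (R : realType) (n : nat) (lam : R).
Local Notation C := (Cplx R).
Local Notation D := (polydisc R n).
Local Notation coord := Defs.coord.
Hypothesis lam_gt0 : 0 < lam.
Variables (A : set (D -> C)) (ip : (D -> C) -> (D -> C) -> C).
Hypothesis hB : is_bergman_space lam A ip.

Let hA : is_hilbert_function_space A ip. Proof. by case: hB. Qed.
Let hK : has_reproducing_kernel A ip (bergman_kernel lam). Proof. by case: hB. Qed.

Let zeta_exists k : exists z : C, k.+1.-primitive_root z.
Proof. by apply: prim_root_exists => //; rewrite pnatr_eq0. Qed.

Let zetaP k := svalP (cid (zeta_exists k)).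

Let u (m : 'I_n -> nat) k : D -> C := fourier lam (ltn0Sn k) (zetaP k) m.

Let half_prod (m : 'I_n -> nat) : C := \prod_(j < n) 2^-1 ^+ m j.

Let half_prod_neq0 m : half_prod m != 0.
Proof. by apply/prodf_neq0 => j _; rewrite expf_neq0// invr_eq0. Qed.

Let u_approx m (e : C) : 0 < e -> exists N0, forall k, (N0 <= k)%N ->
  (forall j, m j < k.+1)%N /\
  forall z, `|u m k z - mon_weight lam m * half_prod m * mon m z| <= e.
Proof.
move=> e0; have half01 : 0 <= (2^-1 : C) < 1 by rewrite invr_ge0 ler0n /= invf_lt1 ?ltr1n ?ltr0n.
have [N0 HN0] := bergman_kernel_approx n lam_gt0 half01 e0.
exists (maxn N0 (\max_j m j)) => k; rewrite geq_max => /andP[Nk mk].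
have mj j : (m j < k.+1)%N by rewrite ltnS (leq_trans _ mk)// (leq_bigmax j).
split=> // z; rewrite /mon_weight /half_prod /mon -!big_split/=.
rewrite (eq_bigr (fun j => cbcoef lam (m j) * (2^-1 * coord z j) ^+ m j)); last first.
  by move=> j _; rewrite exprMn mulrA.
apply: fourier_approx => // x w wr; apply: HN0 => //.
exact: leq_trans Nk _.
Qed.

Let ip_u_approx m m' (e : C) : 0 < e -> exists N0, forall k l, (N0 <= k)%N -> (N0 <= l)%N ->
  `|ip (u m' k) (u m l) - [forall j, m j == m' j]%:R *
     (mon_weight lam m' * half_prod m' * half_prod m)| <= e.
Proof.
move=> e0; have [N1 HN1] := u_approx m' e0; have [N2 HN2] := u_approx m e0.
exists (maxn N1 N2) => k l; rewrite !geq_max => /andP[k1 k2] /andP[l1 l2].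
apply: (ip_fourier_approx hB) => //; first exact: (fourier_in hB).
- by have [] := HN2 l l2.
- by have [] := HN1 l l1.
- by have [] := HN1 k k1.
Qed.

Let u_in m k : A (u m k). Proof. exact: (fourier_in hB). Qed.

(** The squared norm of a difference expands into four inner products, each within e / 4 of the same
    number T; the four copies of T cancel. *)
Let u_limit m : exists2 f, A f & hcvg ip (u m) f.
Proof.
apply: (hcvg_cauchy hA (u_in m)) => e e0.
have e4 : 0 < e / 4 by rewrite divr_gt0.
have [N0 HN0] := ip_u_approx m m e4.
exists N0 => k l kN lN.
rewrite -[leLHS](ger0_norm (hfs_ip_ge0 hA (hfs_sub hA (u_in m k) (u_in m l)))).
rewrite (ip_sub_self hA (u_in m k) (u_in m l)).
set T := [forall j, m j == m j]%:R * (mon_weight lam m * half_prod m * half_prod m) in HN0.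
rewrite (_ : _ + _ = (ip (u m k) (u m k) - T) - (ip (u m k) (u m l) - T)
   - (ip (u m l) (u m k) - T) + (ip (u m l) (u m l) - T)); last by ring.
rewrite [leRHS](_ : e = e / 4 + e / 4 + e / 4 + e / 4); last by field.
apply: le_trans (ler_normD _ _) _; apply: lerD; last exact: HN0.
apply: le_trans (ler_normB _ _) _; apply: lerD; last exact: HN0.
by apply: le_trans (ler_normB _ _) _; apply: lerD; exact: HN0.
Qed.

Let u_limitE m f : A f -> hcvg ip (u m) f ->
  f = (fun z => mon_weight lam m * half_prod m * mon m z).
Proof.
move=> Af uf; apply/funext => z.
apply: (cvg_approx_unique (hcvg_eval hA hK (w := z) (u_in m) Af uf)) => e e0.
have [N0 HN0] := u_approx m e0.
by exists N0 => k /HN0[_]; apply.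
Qed.

Let weight_neq0 m : mon_weight lam m * half_prod m != 0.
Proof. by rewrite mulf_neq0// gt_eqF// mon_weight_gt0. Qed.

Lemma mon_in (m : 'I_n -> nat) : A (mon m).
Proof.
have [f Af /(u_limitE Af) fE] := u_limit m.
have -> : mon m = (fun z => (mon_weight lam m * half_prod m)^-1 * f z).
  by apply/funext => z; rewrite fE mulKf.
exact: (hfs_scale hA).
Qed.

(** [mon m] is, up to a nonzero scalar, the norm limit of the averages [u m k], and the inner
    product of [mon m'] with these averages is known. *)
Lemma ip_mon (m m' : 'I_n -> nat) :
  ip (mon m') (mon m) = [forall j, m j == m' j]%:R / mon_weight lam m.
Proof.
have [f Af uf] := u_limit m; have fE := u_limitE Af uf.
have h : [forall j, m j == m' j]%:R * half_prod m =
    (mon_weight lam m * half_prod m) * (ip (mon m') (mon m)).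
  have <- : ip (mon m') f = (mon_weight lam m * half_prod m) * (ip (mon m') (mon m)).
    rewrite fE (ip_scaler hA)//; try exact: mon_in.
    rewrite (conj_Creal (ger0_real _))// mulr_ge0 ?(ltW (mon_weight_gt0 _ _))//.
    by apply: prodr_ge0 => j _; rewrite exprn_ge0// invr_ge0.
  apply: (can_inj (@conjCK C)); rewrite -(hfs_ip_conj hA (mon_in m') Af).
  apply/esym/(cvg_approx_unique (hcvg_ip hA (u_in m) Af (mon_in m') uf)) => e e0.
  have [N1 HN1] := u_approx m e0.
  have [N2 HN2] := u_approx m' e0.
  exists (maxn N1 N2) => k; rewrite geq_max => /andP[/HN1[mk _] /HN2[m'k _]].
  rewrite (hfs_ip_conj hA (mon_in m') (u_in m k)) -rmorphB norm_conjC.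
  rewrite -[half_prod m]mul1r.
  apply: (ip_fourier_approx hB) => //; first exact: mon_in.
  by move=> z; rewrite mul1r subrr normr0 ltW.
apply: (mulfI (weight_neq0 m)); rewrite -h mulrCA; congr (_ * _).
by rewrite mulrAC divff ?mul1r// gt_eqF// mon_weight_gt0.
Qed.

End BergmanPolynomials.

(** * Cubes of exponents *)

Section MonomialBoxes.
Variable n : nat.
Implicit Types (m : multinom n) (N M : nat).

(** Cubes are preferred to bounds on the total degree because the truncated kernel then factors into
    one-variable partial sums. *)
Definition box N : seq (multinom n) :=
  [seq Multinom [tuple nat_of_ord (t j) | j < n] | t : {ffun 'I_n -> 'I_N}].

Lemma box_uniq N : uniq (box N).
Proof.
rewrite map_inj_uniq ?enum_uniq// => s t /mnmP st; apply/ffunP => j.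
by apply: val_inj; have := st j; rewrite !mnmE.
Qed.

Lemma mem_box N m : (m \in box N) = [forall j, m j < N]%N.
Proof.
apply/mapP/forallP => [[t _ ->] j|mN]; first by rewrite mnmE.
exists [ffun j => Ordinal (mN j)]; first by rewrite mem_enum.
by apply/mnmP => j; rewrite mnmE ffunE.
Qed.

Definition boxD N M : seq (multinom n) := [seq m <- box N | m \notin box M].

Lemma boxD_uniq N M : uniq (boxD N M).
Proof. by rewrite filter_uniq ?box_uniq. Qed.

Lemma big_boxD (V : zmodType) (f : multinom n -> V) N M : (M <= N)%N ->
  \sum_(m <- box N) f m - \sum_(m <- box M) f m = \sum_(m <- boxD N M) f m.
Proof.
move=> MN; have E : \sum_(m <- box M) f m = \sum_(m <- box N | m \in box M) f m.
  rewrite -[RHS]big_filter; apply: perm_big.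
  apply: uniq_perm; rewrite ?filter_uniq ?box_uniq// => m.
  rewrite mem_filter andb_idr// !mem_box => /forallP mM.
  by apply/forallP => j; apply: leq_trans (mM j) MN.
rewrite E [X in X - _](bigID (mem (box M)))/= addrAC subrr add0r.
by rewrite big_filter.
Qed.

End MonomialBoxes.

Lemma monotone_cauchy (R : realType) (S : nat -> Cplx R) (B : Cplx R) :
  (forall N, 0 <= S N) -> (forall N M, (M <= N)%N -> S M <= S N) ->
  (forall N, S N <= B) ->
  forall e : Cplx R, 0 < e -> exists N0, forall N M, (N0 <= M)%N -> (M <= N)%N ->
    S N - S M <= e.
Proof.
move=> S0 Smono SB e /real_of_gt0[d d0 ->{e}].
pose s N := complex.Re (S N).
have SE N : S N = (s N)%:C%C.
  by have := S0 N; rewrite /s; case: (S N) => a b; rewrite lecE/= => /andP[/eqP -> _].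
have smono N M : (M <= N)%N -> s M <= s N by move=> /Smono; rewrite !SE lecR.
have ub : has_ubound (range s).
  exists (complex.Re B) => _ [N _ <-]; have := SB N; rewrite SE.
  by case: (B) => a b; rewrite lecE/= => /andP[].
have cs := nondecreasing_is_cvgn (fun M N => @smono N M) ub.
have /cvgrPdist_le/(_ (d / 2)) := cs; rewrite divr_gt0// => /(_ isT)[N0 _ HN0].
exists N0 => N M N0M MN; rewrite !SE -rmorphB lecR.
have := HN0 M N0M; have := HN0 N (leq_trans N0M MN); rewrite /= !ler_norml.
move=> /andP[? ?] /andP[? ?]; lra.
Qed.

(** * Orthogonal expansion and density of polynomials *)

Section BergmanDensity.
Variables (R : realType) (n : nat) (lam : R).
Local Notation C := (Cplx R).
Local Notation D := (polydisc R n).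
Local Notation coord := Defs.coord.
Local Notation weight := (mon_weight lam).
Hypothesis lam_gt0 : 0 < lam.
Variables (A : set (D -> C)) (ip : (D -> C) -> (D -> C) -> C).
Hypothesis hB : is_bergman_space lam A ip.

Let hA : is_hilbert_function_space A ip. Proof. by case: hB. Qed.
Let hK : has_reproducing_kernel A ip (bergman_kernel lam). Proof. by case: hB. Qed.
Let monA (m : multinom n) : A (mon m). Proof. exact: (mon_in lam_gt0 hB). Qed.

Lemma ip_monX (m m' : multinom n) : ip (mon m') (mon m) = (m' == m)%:R / weight m.
Proof.
rewrite (ip_mon lam_gt0 hB); congr (_%:R / _); congr nat_of_bool.
apply/forallP/eqP => [h|-> //]; apply/mnmP => j; exact/esym/eqP.
Qed.

(** The map [th] on exponents lets the same computation of norms serve for partial sums and for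
    their images under an operator permuting or shifting monomials. *)
Definition monsum (s : seq (multinom n)) (th : multinom n -> multinom n)
  (c : multinom n -> C) : D -> C := fun z => \sum_(m <- s) c m * mon (th m) z.

Lemma monsum_in s th c : A (monsum s th c).
Proof. by apply: (hfs_sum hA). Qed.

Lemma ip_monsum s th c : uniq s -> injective th ->
  ip (monsum s th c) (monsum s th c) = \sum_(m <- s) `|c m| ^+ 2 / weight (th m).
Proof.
move=> us thI; rewrite (ip_suml hA)//; last exact: monsum_in.
rewrite big_seq [RHS]big_seq; apply: eq_bigr => m ms.
rewrite (ip_sumr hA)// (bigD1_seq m)//= big1 => [|m' m'm].
  by rewrite addr0 ip_monX eqxx mul1r mulrA normCK.
by rewrite ip_monX (inj_eq thI) eq_sym (negPf m'm) mul0r mulr0.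
Qed.

Definition kernel_part w N : D -> C :=
  monsum (box n N) id (fun m => weight m * (mon m w)^*).

Lemma kernel_partE w N z :
  kernel_part w N z = \prod_(j < n) bsum lam (coord z j * (coord w j)^*) N.
Proof.
rewrite /bsum bigA_distr_bigA /kernel_part /monsum /box big_map big_enum/=.
apply: eq_bigr => t _; rewrite /mon /mon_weight rmorph_prod/= -!big_split/=.
by apply: eq_bigr => j _; rewrite mnmE rmorphXn/= exprMn; ring.
Qed.

Lemma kernel_part_in w N : A (kernel_part w N).
Proof. exact: monsum_in. Qed.

Lemma kernel_part_norm w N :
  ip (kernel_part w N) (kernel_part w N) = kernel_part w N w.
Proof.
rewrite ip_monsum ?box_uniq// /kernel_part /monsum; apply: eq_bigr => m _.
have w0 := mon_weight_gt0 lam_gt0 m.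
rewrite normrM norm_conjC exprMn (ger0_norm (ltW w0)) normCK.
by field; rewrite gt_eqF.
Qed.

(** The squared distance equals the difference of the values at w of the kernel and of its
    truncation, so the uniform approximation of the kernel suffices. *)
Lemma kernel_part_cvg w : hcvg ip (kernel_part w) ((bergman_kernel lam)^~ w).
Proof.
have [AK repr] := hK w; apply/(hcvgP hA (kernel_part_in w) AK) => e e0.
(* The radius r is the largest modulus of a coordinate of w, or 0 when n = 0. *)
have [r r01 wr] : exists2 r : C, 0 <= r < 1 & forall j, `|coord w j| <= r.
  have [r r0 wr] : exists2 r : C, 0 <= r < 1 & forall j, j \in index_enum 'I_n -> `|coord w j| <= r.
    elim: (index_enum 'I_n) => [|i s [r /andP[r0 r1] IH]].
      by exists 0; rewrite ?lexx ?ltr01.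
    have wi := coord_lt1 w i.
    have rw : `|coord w i| \is Num.real by exact: normr_real.
    case: (real_leP (ger0_real r0) rw) => h.
      exists `|coord w i|; first by rewrite normr_ge0.
      by move=> j; rewrite inE => /predU1P[->//|/IH jr]; apply: le_trans h.
    exists r; first by rewrite r0.
    by move=> j; rewrite inE => /predU1P[->|/IH//]; exact: ltW.
  by exists r => // j; apply: wr; rewrite mem_index_enum.
have [N0 HN0] := bergman_kernel_approx n lam_gt0 r01 (divr_gt0 e0 (ltr0n _ 2)).
exists N0 => N /HN0 /(_ w w wr); rewrite -kernel_partE => h.
rewrite (ip_sub_self hA (kernel_part_in w N) AK) kernel_part_norm.
rewrite (hfs_ip_conj hA (kernel_part_in w N) AK) -!repr ?kernel_part_norm//; try exact: kernel_part_in.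
have k0 : 0 <= kernel_part w N w by rewrite -kernel_part_norm (hfs_ip_ge0 hA)//; exact: kernel_part_in.
rewrite (conj_Creal (ger0_real k0)).
rewrite (_ : _ + _ = bergman_kernel lam w w - kernel_part w N w); last by ring.
have K0 : 0 <= bergman_kernel lam w w by rewrite (repr _ AK) (hfs_ip_ge0 hA).
apply: le_trans (real_ler_norm _) _; first by rewrite rpredB ?ger0_real.
by apply: le_trans h _; rewrite ler_pdivrMr// ler_pMr// ler1n.
Qed.

Definition taylor f m : C := weight m * ip f (mon m).

Definition partial_sum f N : D -> C := monsum (box n N) id (taylor f).

Lemma partial_sum_in f N : A (partial_sum f N).
Proof. exact: monsum_in. Qed.

Let taylor_ip f m : A f -> (taylor f m)^* * ip f (mon m) = `|taylor f m| ^+ 2 / weight m.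
Proof.
move=> Af; have w0 := mon_weight_gt0 lam_gt0 m.
have -> : ip f (mon m) = taylor f m / weight m.
  by rewrite /taylor mulrAC divff ?mul1r// gt_eqF.
by rewrite normCK; ring.
Qed.

Lemma ip_partial_sum f N : A f ->
  ip f (partial_sum f N) = ip (partial_sum f N) (partial_sum f N).
Proof.
move=> Af; rewrite ip_monsum ?box_uniq// (ip_sumr hA)//.
by apply: eq_bigr => m _; rewrite taylor_ip.
Qed.

Lemma bessel f N : A f -> ip (partial_sum f N) (partial_sum f N) <= ip f f.
Proof.
move=> Af; have AN := partial_sum_in f N.
have := hfs_ip_ge0 hA (hfs_sub hA Af AN); rewrite (ip_sub_self hA Af AN).
rewrite (hfs_ip_conj hA Af AN) ip_partial_sum//.
rewrite (conj_Creal (ger0_real (hfs_ip_ge0 hA AN))) addrNK.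
by rewrite subr_ge0.
Qed.

Lemma partial_sum_eval f N w : A f -> partial_sum f N w = ip f (kernel_part w N).
Proof.
move=> Af; rewrite (ip_sumr hA)//; apply: eq_bigr => m _.
rewrite rmorphM/= conjCK (conj_Creal (ger0_real (ltW (mon_weight_gt0 lam_gt0 m)))).
by rewrite /taylor mulrAC.
Qed.

(** The partial sum at w is the inner product of f with the truncated kernel, which converges in
    norm to the kernel. *)
Lemma partial_sum_pointwise f w : A f -> (fun N => partial_sum f N w) @ \oo --> f w.
Proof.
move=> Af; have [AK repr] := hK w.
rewrite (repr f Af) (funext (fun N => partial_sum_eval N w Af)).
have := hcvg_ip hA (kernel_part_in w) AK Af (kernel_part_cvg w).
move=> /cvgrPdist_le h; apply/cvgrPdist_le => e /h[N _ HN]; exists N => // k /HN /=.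
rewrite (hfs_ip_conj hA Af AK) (hfs_ip_conj hA Af (kernel_part_in w k)).
by rewrite -rmorphB norm_conjC.
Qed.

(* The transformation [T] maps the orthogonal system of the monomials to itself,
   so that it is bounded on polynomials by the weights alone. *)
Section WeightedComposition.
Variables (g : D -> C) (tau : D -> D) (th : multinom n -> multinom n) (kap : C).
Let T (f : D -> C) : D -> C := fun z => g z * f (tau z).
Hypotheses (T_mon : forall m : multinom n, T (mon m) = mon (th m)) (thI : injective th).
Hypotheses (kap_gt0 : 0 < kap) (kapP : forall m : multinom n, weight m <= kap * weight (th m)).

Let T_monsum s c : T (monsum s id c) = monsum s th c.
Proof.
apply/funext => z; rewrite /T /monsum mulr_sumr; apply: eq_bigr => m _.
by rewrite -T_mon /T mulrCA.
Qed.

Let T_partial_in f N : A (T (partial_sum f N)).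
Proof. by rewrite T_monsum; exact: monsum_in. Qed.

(** Both sides are sums over the exponents lying in the larger box only. Injectivity of [th] keeps
    the images orthogonal, and [kapP] compares the terms one by one. *)
Let T_boxD f N M : (M <= N)%N ->
  ip (fun z => T (partial_sum f N) z - T (partial_sum f M) z)
     (fun z => T (partial_sum f N) z - T (partial_sum f M) z) <=
  kap * (ip (partial_sum f N) (partial_sum f N) - ip (partial_sum f M) (partial_sum f M)).
Proof.
move=> MN; rewrite !ip_monsum ?box_uniq// big_boxD//.
rewrite (_ : (fun z => _) = monsum (boxD n N M) th (taylor f)); last first.
  by apply/funext => z; rewrite !T_monsum /monsum big_boxD.
rewrite ip_monsum ?boxD_uniq// mulr_sumr; apply: ler_sum => m _.
have w0 := mon_weight_gt0 lam_gt0 m; have w1 := mon_weight_gt0 lam_gt0 (th m).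
rewrite mulrCA ler_wpM2l ?exprn_ge0// ler_pdivlMr// mulrC ler_pdivrMr//.
Qed.

(** The squared norms of the partial sums increase and are bounded by Bessel's inequality, hence are
    Cauchy; the previous estimate carries this over to the images. *)
Let T_limit f : A f -> exists2 h, A h & hcvg ip (fun N => T (partial_sum f N)) h.
Proof.
move=> Af; apply: (hcvg_cauchy hA (T_partial_in f)) => e e0.
have mono N M : (M <= N)%N ->
    ip (partial_sum f M) (partial_sum f M) <= ip (partial_sum f N) (partial_sum f N).
  move=> MN; rewrite -subr_ge0 !ip_monsum ?box_uniq// big_boxD//.
  by apply: sumr_ge0 => m _; rewrite divr_ge0 ?exprn_ge0// ltW// mon_weight_gt0.
have [N0 HN0] := monotone_cauchy (fun N => hfs_ip_ge0 hA (partial_sum_in f N)) mono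
  (fun N => bessel N Af) (divr_gt0 e0 kap_gt0).
have HN N M : (N0 <= M)%N -> (M <= N)%N ->
  ip (fun z => T (partial_sum f N) z - T (partial_sum f M) z)
     (fun z => T (partial_sum f N) z - T (partial_sum f M) z) <= e.
  move=> N0M MN; apply: le_trans (T_boxD f MN) _.
  by rewrite mulrC -ler_pdivlMr// HN0.
exists N0 => k l kN lN; have [lk|kl] := leqP l k; first exact: HN.
rewrite (ip_sub_selfC hA (T_partial_in f k) (T_partial_in f l)).
exact: HN (ltnW kl).
Qed.

Let T_limitE f h : A f -> (forall z, (fun N => partial_sum f N z) @ \oo --> f z) ->
  A h -> hcvg ip (fun N => T (partial_sum f N)) h -> h = T f.
Proof.
move=> Af fcvg Ah hcv; apply/funext => z.
apply: (cvg_approx_unique (hcvg_eval hA hK (w := z) (T_partial_in f) Ah hcv)) => e e0.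
(* The added 1 allows dividing even where g vanishes. *)
have g1 : 0 < `|g z| + 1 by rewrite ltr_wpDl.
have /cvgrPdist_le/(_ _ (divr_gt0 e0 g1))[N _ HN] := fcvg (tau z).
exists N => k /HN /= h1; rewrite /T -mulrBr normrM distrC.
rewrite ler_pdivlMr// in h1; apply: le_trans h1.
by rewrite mulrC ler_wpM2l// lerDl.
Qed.

Lemma weighted_composition f : A f ->
  A (T f) /\ hcvg ip (fun N => T (partial_sum f N)) (T f).
Proof.
move=> Af; have [h Ah hcv] := T_limit Af.
by rewrite -(T_limitE Af (fun z => @partial_sum_pointwise f z Af) Ah hcv).
Qed.

End WeightedComposition.

End BergmanDensity.

(** * Permutations of variables and multiplication by polynomials *)

Section BergmanOperations.
Variables (R : realType) (n : nat) (lam : R).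
Local Notation C := (Cplx R).
Local Notation D := (polydisc R n).
Local Notation coord := Defs.coord.
Local Notation weight := (mon_weight lam).
Hypothesis lam_gt0 : 0 < lam.
Variables (A : set (D -> C)) (ip : (D -> C) -> (D -> C) -> C).
Hypothesis hB : is_bergman_space lam A ip.

Let hA : is_hilbert_function_space A ip. Proof. by case: hB. Qed.
Let hK : has_reproducing_kernel A ip (bergman_kernel lam). Proof. by case: hB. Qed.
Let monA (m : multinom n) : A (mon m). Proof. exact: (mon_in lam_gt0 hB). Qed.

(** The weighted composition with weight 1 and the identity map: pointwise convergence becomes norm
    convergence. *)
Lemma partial_sum_cvg f : A f -> hcvg ip (partial_sum lam ip f) f.
Proof.
move=> Af.
have T_mon (m : multinom n) : (fun z => 1 * mon m z) = mon m :> (D -> C).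
  by apply/funext => z; rewrite mul1r.
have kapP (m : multinom n) : weight m <= 1 * weight m by rewrite mul1r.
have [_] := weighted_composition lam_gt0 hB (g := fun=> 1) (tau := id) (th := id)
  T_mon (@inj_id _) ltr01 kapP Af.
rewrite (_ : (fun z => 1 * f z) = f); last by apply/funext => z; rewrite mul1r.
rewrite (_ : (fun N => _) = partial_sum lam ip f)//.
by apply/funext => N; apply/funext => z; rewrite mul1r.
Qed.

Definition perm_mnm (s : 'S_n) (m : multinom n) : multinom n :=
  Multinom [tuple m (s j) | j < n].

Lemma perm_mnm_inj s : injective (perm_mnm s).
Proof.
move=> m m' /mnmP mm'; apply/mnmP => j.
by have := mm' (s^-1%g j); rewrite !mnmE permKV.
Qed.

Lemma coord_perm (s : 'S_n) (z : D) j : coord (perm_pt s z) j = coord z (s^-1%g j).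
Proof. by rewrite /coord /= mxE. Qed.

Lemma mon_perm s (m : multinom n) (z : D) : mon m (perm_pt s z) = mon (perm_mnm s m) z.
Proof.
rewrite /mon (reindex_inj (@perm_inj _ s))/=; apply: eq_bigr => j _.
by rewrite mnmE coord_perm permK.
Qed.

Lemma weight_perm s (m : multinom n) : weight (perm_mnm s m) = weight m.
Proof.
rewrite /mon_weight [RHS](reindex_inj (@perm_inj _ s))/=.
by apply: eq_bigr => j _; rewrite mnmE.
Qed.

Lemma perm_composition s f : A f -> A (fun z => f (perm_pt s z)) /\
  hcvg ip (fun N z => partial_sum lam ip f N (perm_pt s z)) (fun z => f (perm_pt s z)).
Proof.
move=> Af.
have E h : (fun z => 1 * h (perm_pt s z)) = (fun z => h (perm_pt s z)) :> (D -> C).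
  by apply/funext => z; rewrite mul1r.
have T_mon (m : multinom n) : (fun z => 1 * mon m (perm_pt s z)) = mon (perm_mnm s m) :> (D -> C).
  by apply/funext => z; rewrite mul1r mon_perm.
have kapP (m : multinom n) : weight m <= 1 * weight (perm_mnm s m).
  by rewrite mul1r weight_perm.
have := weighted_composition lam_gt0 hB T_mon (@perm_mnm_inj s) ltr01 kapP Af.
rewrite E (_ : (fun N => _) = (fun N z => partial_sum lam ip f N (perm_pt s z)))//.
by apply/funext => N; rewrite E.
Qed.

Lemma perm_in s f : A f -> A (fun z => f (perm_pt s z)).
Proof. by case/(perm_composition s). Qed.

Lemma ip_perm_self s f : A f ->
  ip (fun z => f (perm_pt s z)) (fun z => f (perm_pt s z)) = ip f f.
Proof.
move=> Af; have [Asf sf] := perm_composition s Af.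
have AN N := partial_sum_in lam_gt0 hB f N.
have AsN N := perm_in s (AN N).
have c1 := hcvg_ip_self hA AsN Asf sf.
have c2 := hcvg_ip_self hA AN Af (partial_sum_cvg Af).
have E N : ip (fun z => partial_sum lam ip f N (perm_pt s z))
    (fun z => partial_sum lam ip f N (perm_pt s z)) =
    ip (partial_sum lam ip f N) (partial_sum lam ip f N).
  rewrite (_ : (fun z => _) = monsum (box n N) (perm_mnm s) (taylor lam ip f)); last first.
    by apply/funext => z; apply: eq_bigr => m _; rewrite mon_perm.
  rewrite !(ip_monsum lam_gt0 hB) ?box_uniq//; last exact: perm_mnm_inj.
  by apply: eq_bigr => m _; rewrite weight_perm.
apply: (cvg_approx_unique c1) => e e0.
have /cvgrPdist_le/(_ e e0)[N _ HN] := c2.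
by exists N => k /HN; rewrite /= E distrC.
Qed.

(** Polarization: invariance of the norms of all f - a g gives a^* q + a q' = 0, and the choices a =
    1 and a = i force q = 0. *)
Lemma ip_perm s f g : A f -> A g ->
  ip (fun z => f (perm_pt s z)) (fun z => g (perm_pt s z)) = ip f g.
Proof.
move=> Af Ag; have Asf := perm_in s Af; have Asg := perm_in s Ag.
pose q := ip (fun z => f (perm_pt s z)) (fun z => g (perm_pt s z)) - ip f g.
pose q' := ip (fun z => g (perm_pt s z)) (fun z => f (perm_pt s z)) - ip g f.
have polar a : a^* * q + a * q' = 0.
  have Aag := hfs_scale hA a Ag; have Asag := hfs_scale hA a Asg.
  have := ip_perm_self s (hfs_sub hA Af Aag).
  rewrite (ip_sub_self hA Af Aag) (ip_sub_self hA Asf Asag).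
  rewrite !(ip_scaler hA)// !(ip_scalel hA)// !ip_perm_self//.
  rewrite /q /q' => /eqP; rewrite -subr_eq0 => /eqP h.
  by rewrite -[RHS]oppr0 -h; ring.
have p1 := polar 1; have p2 := polar 'i.
rewrite conjC1 !mul1r in p1; rewrite conjCi in p2.
have q'E : q' = - q by apply/eqP; rewrite -addr_eq0 addrC p1.
have : - 'i *+ 2 * q = 0 by rewrite -p2 q'E; ring.
move/eqP; rewrite mulf_eq0 mulrn_eq0 /= oppr_eq0 (negPf (neq0Ci _)).
by rewrite /= subr_eq0 => /eqP.
Qed.

(** Amounts to k + 1 <= (1 + 1/lam) (lam + k), whose right side is lam + k + 1 + k/lam. It provides
    the constant bounding multiplication by a variable. *)
Lemma bcoef_ratio k : bcoef lam k <= (1 + lam^-1) * bcoef lam k.+1.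
Proof.
have k1 : 0 < k.+1%:R :> R by rewrite ltr0n.
rewrite -(ler_pM2l k1) mulrCA bcoefS mulrA ler_wpM2r ?(ltW (bcoef_gt0 _ _))//.
rewrite mulrDl mul1r mulrDr mulVf ?gt_eqF// -natr1.
have : 0 <= lam^-1 * k%:R by rewrite mulr_ge0// invr_ge0 ltW.
by move: lam_gt0; lra.
Qed.

Lemma bcoef_ratio_exp k i : bcoef lam k <= (1 + lam^-1) ^+ i * bcoef lam (i + k).
Proof.
have l0 : 0 <= 1 + lam^-1 by rewrite addr_ge0// invr_ge0 ltW.
elim: i => [|i IH]; first by rewrite mul1r.
apply: le_trans IH _; rewrite exprSr -mulrA ler_wpM2l ?exprn_ge0//.
exact: bcoef_ratio.
Qed.

Lemma mon_mul_in (m : multinom n) f : A f -> A (fun z => mon m z * f z).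
Proof.
move=> Af; pose kap : C := \prod_(j < n) (((1 + lam^-1) ^+ m j)%:C)%C.
have T_mon (m' : multinom n) : (fun z => mon m z * mon m' z) = mon (mnm_add m m') :> (D -> C).
  apply/funext => z; rewrite /mon -big_split/=; apply: eq_bigr => j _.
  by rewrite mnmDE exprD.
have thI : injective (mnm_add m).
  by move=> m1 m2 /mnmP h; apply/mnmP => j; have := h j; rewrite !mnmDE => /addnI.
have kap0 : 0 < kap.
  by apply: prodr_gt0 => j _; rewrite ltcR exprn_gt0// ltr_wpDr// invr_ge0 ltW.
have kapP (m' : multinom n) : weight m' <= kap * weight (mnm_add m m').
  rewrite /mon_weight /kap -big_split/=; apply: ler_prod => j _.
  rewrite ltW ?cbcoef_gt0//= mnmDE -rmorphM lecR.
  exact: bcoef_ratio_exp.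
by have [] := weighted_composition lam_gt0 hB (tau := id) T_mon thI kap0 kapP Af.
Qed.

Lemma poly_act_in (phi : mpoly.mpoly n C) f : A f -> A (poly_act phi f).
Proof.
move=> Af; rewrite (_ : poly_act phi f =
  (fun z => \sum_(m <- msupp phi) mcoeff m phi * (mon m z * f z))).
  by apply: (hfs_sum hA) => m; exact: mon_mul_in.
apply/funext => z; rewrite /poly_act mevalE mulr_suml; apply: eq_bigr => m _.
by rewrite mulrA.
Qed.

Definition polyfun (phi : mpoly.mpoly n C) : D -> C := fun z => meval (coord z) phi.

Lemma polyfun_in phi : A (polyfun phi).
Proof.
rewrite (_ : polyfun phi = monsum (msupp phi) id (fun m => mcoeff m phi)).
  exact: (monsum_in lam_gt0 hB).
by apply/funext => z; rewrite /polyfun mevalE.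
Qed.

(** Orthogonality to the monomials kills every Taylor coefficient, hence every partial sum. *)
Lemma polyfun_dense f : A f -> (forall phi, ip (polyfun phi) f = 0) -> f = (fun=> 0).
Proof.
move=> Af f0; apply/funext => w.
apply: (cvg_approx_unique (partial_sum_pointwise lam_gt0 hB (w := w) Af)) => e e0.
exists 0%N => k _; rewrite subr0 /partial_sum /monsum big1 ?normr0 ?ltW// => m _.
have : ip (mon m) f = 0.
  rewrite -(f0 (mpolyX C m)); congr ip.
  by apply/funext => z; rewrite /polyfun mevalX.
by rewrite /taylor (hfs_ip_conj hA (monA m) Af) => ->; rewrite conjC0 mulr0 mul0r.
Qed.

End BergmanOperations.

(** * Projections attached to irreducible representations *)

Section SchurOrthogonality.
Variables (F : closedFieldType) (gT : finGroupType) (G : {group gT}) (d : nat).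
Variable rG : mx_representation F G d.
Hypothesis irrG : mx_irreducible rG.

Lemma irr_dim_gt0 : (0 < d)%N.
Proof.
have [_ nz _] := irrG; rewrite lt0n; apply: contra_neq nz => d0.
by apply/matrixP => i; have := ltn_ord i; rewrite {2}d0.
Qed.

(** Subtracting an eigenvalue gives a singular matrix in the commutant, which vanishes by Schur's
    lemma. *)
Lemma schur_scalar (M : 'M[F]_d) : centgmx rG M -> exists c, M = c%:M.
Proof.
move=> cM; have d0 := irr_dim_gt0.
have /closed_rootP[c] : size (char_poly M) != 1%N by rewrite size_char_poly eqSS -lt0n.
rewrite -eigenvalue_root_char => /eigenvalueP[v vM vnz].
exists c; apply/eqP; rewrite -subr_eq0; apply: contraT => nz.
have cMc : centgmx rG (M - c%:M).
  apply/centgmxP => x xG; rewrite mulmxBl mulmxBr (centgmxP cM)//.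
  by rewrite scalar_mxC.
have := mx_Schur irrG cMc nz; rewrite -row_free_unit => /row_free_inj inj.
move: vnz; rewrite (inj 1%N v 0) ?eqxx// mul0mx mulmxBr vM.
by rewrite mul_mx_scalar subrr.
Qed.

(** Averaging conjugates of an elementary matrix gives an element of the commutant, hence a scalar,
    which the trace determines. *)
Lemma schur_orthogonality (i j k l : 'I_d) :
  d%:R * \sum_(s in G) rG s^-1%g i k * rG s l j =
  (i == j)%:R * (k == l)%:R * #|G|%:R.
Proof.
pose M := \sum_(s in G) rG s^-1%g *m delta_mx k l *m rG s.
have ME a b : M a b = \sum_(s in G) rG s^-1%g a k * rG s l b.
  rewrite summxE; apply: eq_bigr => s _; rewrite !mxE (bigD1 l)//= big1.
    rewrite addr0 !mxE (bigD1 k)//= big1; first by rewrite addr0 !mxE !eqxx mulr1.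
    by move=> k' /negPf kk; rewrite !mxE kk mulr0.
  move=> l' /negPf ll; rewrite !mxE big1 ?mul0r// => k' _.
  by rewrite !mxE ll andbF mulr0.
have cM : centgmx rG M.
  apply/centgmxP => x xG; rewrite mulmx_suml mulmx_sumr.
  rewrite [RHS](reindex_inj (mulIg x))/= [RHS](eq_bigl (mem G)); last first.
    by move=> s; rewrite /= groupMr.
  apply: eq_bigr => s sG; rewrite invMg !repr_mxM ?groupV//.
  by rewrite !mulmxA -[rG x *m rG x^-1%g]repr_mxM ?groupV// mulgV repr_mx1 mul1mx.
have [c Mc] := schur_scalar cM.
have trM : \tr M = (k == l)%:R * #|G|%:R.
  rewrite raddf_sum/= (eq_bigr (fun=> (k == l)%:R)); last first.
    move=> s sG; rewrite mxtrace_mulC mulmxA -repr_mxM ?groupV// mulgV repr_mx1 mul1mx.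
    rewrite /mxtrace (bigD1 k)//= big1; first by rewrite mxE eqxx addr0.
    by move=> k' /negPf kk; rewrite mxE kk.
  by rewrite sumr_const mulr_natr.
rewrite -ME Mc mxE -mulrA; move: trM; rewrite Mc mxtrace_scalar => <-.
by case: (i == j); rewrite ?mulr1n ?mulr0n ?mul1r ?mul0r ?mulr0// mulr_natl.
Qed.

End SchurOrthogonality.

(** In a full rank factorization P = c r, idempotence forces r c = 1, and the trace of c r is that
    of r c. *)
Lemma idempotent_rank (F : fieldType) (N : nat) (P : 'M[F]_N) :
  P *m P = P -> \tr P = (\rank P)%:R.
Proof.
move: (mulmx_base P) (row_base_free P) (col_base_full P).
move: (col_base P) (row_base P) => c r cr rfree cfull PP.
have rc : r *m c = 1%:M.
  apply: (row_free_inj rfree); apply: (row_full_inj cfull).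
  by rewrite mul1mx !mulmxA cr -mulmxA cr PP.
by rewrite -{1}cr mxtrace_mulC rc mxtrace1.
Qed.

Lemma mxrank_le_ker (F : fieldType) (m k l : nat) (X : 'M[F]_(m, k)) (Y : 'M[F]_(m, l)) :
  (forall y : 'rV_m, y *m X = 0 -> y *m Y = 0) -> (\rank Y <= \rank X)%N.
Proof.
move=> XY; have : (kermx X <= kermx Y)%MS.
  apply/sub_kermxP/row_matrixP => i; rewrite row_mul row0; apply: XY.
  by rewrite -row_mul mulmx_ker row0.
by move=> /mxrankS; rewrite !mxrank_ker leq_sub2lE ?rank_leq_row.
Qed.

(** * Idempotents of the group algebra and their ranks *)

Section GroupAverage.
Variables (R : realType) (n : nat).
Local Notation C := (Cplx R).
Local Notation D := (polydisc R n).
Implicit Types (a b : 'S_n -> C) (f : D -> C).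

Lemma perm_pt_comp (s t : 'S_n) (z : D) : perm_pt s (perm_pt t z) = perm_pt (t * s)%g z.
Proof.
apply: val_inj; apply/rowP => j; rewrite !mxE invMg permM.
by [].
Qed.

Lemma perm_pt1 (z : D) : perm_pt 1%g z = z.
Proof. by apply: val_inj; apply/rowP => j; rewrite !mxE invg1 perm1. Qed.

Definition gavg a f : D -> C := fun z => \sum_(s : 'S_n) a s * f (perm_pt s^-1%g z).

(** Idempotence for convolution and self-adjointness for the involution of the group algebra; these
    make [gavg a] an orthogonal projection on the Bergman space. *)
Definition projector a : Prop :=
  (forall u, \sum_s a s * a (u * s^-1)%g = a u) /\ (forall s, a s^-1%g = (a s)^*).

Lemma gavg_idem a f : projector a -> gavg a (gavg a f) = gavg a f.
Proof.
move=> [aa _]; apply/funext => z; rewrite /gavg.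
under eq_bigr => s _ do rewrite mulr_sumr.
transitivity (\sum_s \sum_u a s * (a (u * s^-1)%g * f (perm_pt u^-1%g z))).
  apply: eq_bigr => s _; rewrite (reindex_inj (mulIg s^-1%g))/=.
  by apply: eq_bigr => u _; rewrite perm_pt_comp invMg invgK mulKg.
rewrite exchange_big/=; apply: eq_bigr => u _.
by rewrite -(aa u) mulr_suml; apply: eq_bigr => s _; rewrite mulrA.
Qed.

(** The matrix of a in a regular representation; it describes the action of [gavg a] on the kernels
    along a free orbit. *)
Definition gmatrix a : 'M[C]_#|{: 'S_n}| :=
  \matrix_(i, j) a ((enum_val i)^-1 * enum_val j)%g.

Lemma gmatrix_idem a : projector a -> gmatrix a *m gmatrix a = gmatrix a.
Proof.
move=> [aa _]; apply/matrixP => i j; rewrite !mxE.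
under eq_bigr => k _ do rewrite !mxE.
rewrite -(big_enum_val (fun s => a ((enum_val i)^-1 * s)%g * a (s^-1 * enum_val j)%g))/=.
rewrite -(aa (_ * _)%g) (reindex_inj invg_inj)/= (reindex_inj (mulIg (enum_val j)^-1%g))/=.
by apply: eq_bigr => s _; rewrite !invMg !invgK mulgKV mulrC mulgA.
Qed.

(** The rank of an idempotent is its trace, and all n! diagonal entries equal [a 1]. *)
Lemma gmatrix_rank a : projector a -> (\rank (gmatrix a))%:R = (n`!)%:R * a 1%g.
Proof.
move=> pa; rewrite -idempotent_rank ?gmatrix_idem// /mxtrace.
under eq_bigr => i _ do rewrite mxE mulVg.
by rewrite sumr_const card_ord -[LHS]mulr_natl card_Sn.
Qed.

Section Irreducible.
Variables (d : nat) (rG : mx_representation C [group of [set: 'S_n]] d).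
Hypotheses (irr : mx_irreducible rG) (uni : forall s, rep_mat rG s \is unitarymx).

(** The transposition in [rep_mat] leaves diagonal entries unchanged, so [rG] is used directly. *)
Definition coef_ii (i : 'I_d) (s : 'S_n) : C := d%:R / n`!%:R * rG s^-1%g i i.

Lemma chi1 : chi rG 1%g = d%:R.
Proof. by rewrite /chi /rep_mat mxtrace_tr repr_mx1 mxtrace1. Qed.

Lemma Pij_gavg i : Pij rG i i = gavg (coef_ii i).
Proof.
apply/funext => f; apply/funext => z; rewrite /Pij chi1 mulr_sumr.
by apply: eq_bigr => s _; rewrite /coef_ii /rep_mat mxE mulrA.
Qed.

Lemma Pp_gavg : Pp rG = gavg (fun s => \sum_i coef_ii i s).
Proof.
apply/funext => f; apply/funext => z; rewrite /Pp.
under eq_bigr => i _ do rewrite Pij_gavg /gavg.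
by rewrite exchange_big/=; apply: eq_bigr => s _; rewrite mulr_suml.
Qed.

(** Expanding the matrix entry of the product s u^-1 reduces the convolution to Schur
    orthogonality. *)
Lemma coef_conv i j u :
  \sum_s coef_ii i s * coef_ii j (u * s^-1)%g = (i == j)%:R * coef_ii i u.
Proof.
have d0 : d%:R != 0 :> C by rewrite pnatr_eq0 -lt0n (irr_dim_gt0 irr).
have n0 : n`!%:R != 0 :> C by rewrite pnatr_eq0 -lt0n fact_gt0.
have orth k : \sum_s rG s^-1%g i i * rG s j k =
    (i == k)%:R * (i == j)%:R * n`!%:R / d%:R.
  apply: (mulfI d0); have := schur_orthogonality irr i k i j.
  rewrite cardsT card_Sn => <-; rewrite mulrCA divff// mulr1.
  by congr (_ * _); apply: eq_bigl => s; rewrite inE.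
transitivity ((d%:R / n`!%:R) ^+ 2 *
    \sum_k rG u^-1%g k j * \sum_s rG s^-1%g i i * rG s j k).
  rewrite mulr_sumr; under [RHS]eq_bigr => k _ do rewrite mulr_sumr mulr_sumr.
  rewrite exchange_big/=; apply: eq_bigr => s _.
  rewrite /coef_ii invMg invgK repr_mxM ?inE// mxE !mulr_sumr.
  by apply: eq_bigr => k _; ring.
rewrite (bigD1 i)//= [X in _ * (_ + X)]big1 ?addr0 => [|k /negPf ki]; last first.
  by rewrite orth eq_sym ki !mul0r mulr0.
rewrite orth eqxx /coef_ii mul1r.
have [<-|_] := eqVneq i j; last by rewrite !mul0r !mulr0.
by rewrite !mul1r; field; rewrite ?n0 ?d0.
Qed.

Lemma coef_conj i s : coef_ii i s^-1%g = (coef_ii i s)^*.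
Proof.
rewrite /coef_ii invgK rmorphM fmorph_div/= !conjC_nat; congr (_ * _).
have /unitarymxP u := uni s.
have e : rG s *m rG s^-1%g = 1%:M by rewrite -repr_mxM ?inE// mulgV repr_mx1.
have e' : (rG s^-1%g)^T *m (rG s)^T = 1%:M by rewrite -trmx_mul e trmx1.
have -> : rG s^-1%g i i = (rG s^-1%g)^T i i by rewrite [RHS]mxE.
have <- : ((rep_mat rG s) ^t* )%sesqui = (rG s^-1%g)^T.
  by rewrite -[LHS]mul1mx -e' -mulmxA u mulmx1.
by rewrite !mxE conjCK.
Qed.

Lemma projector_ii i : projector (coef_ii i).
Proof.
by split=> [u|]; [rewrite coef_conv eqxx mul1r | exact: coef_conj].
Qed.

Lemma projector_sum : projector (fun s => \sum_i coef_ii i s).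
Proof.
split=> [u|s]; last by rewrite rmorph_sum; apply: eq_bigr => i _; rewrite coef_conj.
under eq_bigr => s _ do rewrite mulr_suml.
rewrite exchange_big/=; apply: eq_bigr => i _.
under eq_bigr => s _ do rewrite mulr_sumr.
rewrite exchange_big/= (bigD1 i)//= [X in _ + X]big1 => [|j /negPf ji].
  by rewrite addr0 coef_conv eqxx mul1r.
by rewrite coef_conv eq_sym ji mul0r.
Qed.

Lemma coef_ii1 i : n`!%:R * coef_ii i 1%g = d%:R.
Proof.
by rewrite /coef_ii invg1 repr_mx1 mxE eqxx mulr1 mulrC divfK// pnatr_eq0 -lt0n fact_gt0.
Qed.

End Irreducible.

End GroupAverage.

(** * Functionals that are eigenvectors of the symmetric polynomials *)

Section SymmetricEigenfunctionals.
Variables (F : fieldType) (n : nat).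
Local Notation P := (mpoly.mpoly n F).
Implicit Types (p f : P) (s t : 'S_n).

Lemma meval_msym (v : 'I_n -> F) s p : meval v (msym s p) = meval (v \o s) p.
Proof.
rewrite (mpolyE p) (raddf_sum (msym s)) (raddf_sum (meval v)) (raddf_sum (meval (v \o s)))/=.
apply: eq_bigr => m _; rewrite msymZ !mevalZ msymX !mevalX; congr (_ * _).
rewrite (reindex_inj (@perm_inj _ s))/=; apply: eq_bigr => j _.
by rewrite mnmE permK.
Qed.

Let N := #|{: 'S_n}|.

Let rank_mul s (i : 'I_N) : 'I_N := enum_rank (enum_val i * s)%g.

Let rank_mul_inj s : injective (rank_mul s).
Proof. by move=> i j /enum_rank_inj/mulIg/enum_val_inj. Qed.

Let orbit_col f : 'cV[P]_N := \col_i msym (enum_val i) f.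

Let msym_orbit_col s f : map_mx (msym s) (orbit_col f) =
  row_perm (perm (@rank_mul_inj s)) (orbit_col f).
Proof.
by apply/matrixP => i j; rewrite !mxE permE /rank_mul enum_rankK msymMm.
Qed.

Section Cramer.
Variable b : 'I_N -> P.

Definition orbit_mx : 'M[P]_N := \matrix_(i, j) msym (enum_val i) (b j).

Let msym_orbit_mx s : map_mx (msym s) orbit_mx =
  row_perm (perm (@rank_mul_inj s)) orbit_mx.
Proof.
by apply/matrixP => i j; rewrite !mxE permE /rank_mul enum_rankK msymMm.
Qed.

(** Permuting the variables permutes the rows, which changes the determinant by a sign only. *)
Lemma det_orbit_sym : \det orbit_mx ^+ 2 \is symmetric.
Proof.
apply/issymP => s; rewrite rmorphXn/= -det_map_mx msym_orbit_mx row_permE det_mulmx.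
by rewrite det_perm exprMn sqrr_sign mul1r.
Qed.

Hypothesis det_neq0 : \det orbit_mx != 0.

Definition cramer_coef f : 'cV[P]_N := \det orbit_mx *: (\adj orbit_mx *m orbit_col f).

Let orbit_cramer f : orbit_mx *m cramer_coef f = \det orbit_mx ^+ 2 *: orbit_col f.
Proof.
by rewrite -scalemxAr mulmxA mul_mx_adj mul_scalar_mx scalerA.
Qed.

(* [det B *: (adj B *m v)] solves [B *m y = det B ^+ 2 *: v]; a permutation of
   the variables permutes the rows of both sides, so the unique solution is
   made of symmetric polynomials. *)
Lemma cramer_coef_sym f j : cramer_coef f j 0 \is symmetric.
Proof.
apply/issymP => s.
suff : map_mx (msym s) (cramer_coef f) = cramer_coef f.
  by move=> /matrixP/(_ j 0); rewrite mxE.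
have eq1 : orbit_mx *m map_mx (msym s) (cramer_coef f) = orbit_mx *m cramer_coef f.
  have := congr1 (map_mx (msym s)) (orbit_cramer f).
  have -> : map_mx (msym s) (orbit_mx *m cramer_coef f) =
      map_mx (msym s) orbit_mx *m map_mx (msym s) (cramer_coef f) by exact: map_mxM.
  have -> : map_mx (msym s) (\det orbit_mx ^+ 2 *: orbit_col f) =
      msym s (\det orbit_mx ^+ 2) *: map_mx (msym s) (orbit_col f) by exact: map_mxZ.
  rewrite msym_orbit_mx msym_orbit_col.
  have /issymP -> := det_orbit_sym.
  rewrite !row_permE -mulmxA scalemxAr => /(congr1 (mulmx (invmx (perm_mx (perm (@rank_mul_inj s)))))).
  by rewrite !mulKmx ?unitmx_perm// -orbit_cramer.
have := congr1 (mulmx (\adj orbit_mx)) eq1.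
rewrite !mulmxA mul_adj_mx !mul_scalar_mx => /matrixP eq2.
apply/matrixP => i k; apply: (mulfI det_neq0).
by have := eq2 i k; rewrite mxE => ->; rewrite mxE.
Qed.

(** The row of the identity permutation in the linear system. *)
Lemma cramer_expansion f :
  \det orbit_mx ^+ 2 * f = \sum_j cramer_coef f j 0 * b j.
Proof.
have /matrixP/(_ (enum_rank 1%g) 0) := orbit_cramer f.
rewrite !mxE enum_rankK msym1m => <-; apply: eq_bigr => j _.
by rewrite mxE enum_rankK msym1m mulrC.
Qed.

End Cramer.

Variable w : 'I_n -> F.
Hypothesis w_inj : injective w.

(** A product of differences X_i - w_j, whose value at the point of the orbit given by s is nonzero
    only if s sends each i to t^-1 i. *)
Let sep t : P := \prod_i \prod_(j | j != t^-1%g i) (mpolyX F (mnm1 i) - mpolyC n (w j)).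

Let meval_sep t s : meval w (msym s (sep t)) = \prod_i \prod_(j | j != t^-1%g i) (w (s i) - w j).
Proof.
rewrite meval_msym rmorph_prod; apply: eq_bigr => i _; rewrite rmorph_prod.
by apply: eq_bigr => j _; rewrite rmorphB/= mevalXU mevalC.
Qed.

Lemma orbit_separation t : exists p : P,
  meval w (msym t p) != 0 /\ forall s, s != t -> meval w (msym s p) = 0.
Proof.
exists (sep t^-1%g); split=> [|s st].
  rewrite meval_sep invgK; apply/prodf_neq0 => i _; apply/prodf_neq0 => j ji.
  by rewrite subr_eq0 (inj_eq w_inj) eq_sym.
have /existsP[k kk] : [exists k, s k != t k].
  rewrite -negb_forall; apply: contra st => /forallP h; apply/eqP/permP => k.
  exact/eqP.
by rewrite meval_sep invgK (bigD1 k)//= (bigD1 (s k))//= subrr !mul0r.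
Qed.

Let separating (j : 'I_N) : P := sval (cid (orbit_separation (enum_val j))).

(** Evaluated at w, the orbit matrix of the separating polynomials is diagonal with nonzero
    entries. *)
Let orbit_det_neq0 : meval w (\det (orbit_mx separating)) != 0.
Proof.
rewrite -det_map_mx; set M := map_mx _ _.
have Mij i j : M i j = meval w (msym (enum_val i) (separating j)) by rewrite !mxE.
have -> : M = diag_mx (\row_j M j j).
  apply/matrixP => i j; rewrite [RHS]mxE [X in _ = X *+ _]mxE.
  have [->|ij] := eqVneq i j; first by rewrite mulr1n.
  have [_ sepj] := svalP (cid (orbit_separation (enum_val j))).
  by rewrite mulr0n Mij sepj// (inj_eq enum_val_inj).
rewrite det_diag; apply/prodf_neq0 => i _; rewrite mxE Mij.
by have [] := svalP (cid (orbit_separation (enum_val i))).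
Qed.

(** L is applied to the Cramer expansion of p. All coefficients there are symmetric, so L evaluates
    them at w; these values are combinations of the values of p on the orbit, and the squared
    determinant on the left is nonzero at w. *)
Lemma symmetric_eigenfunctional (L : P -> F) :
  (forall p q, L (p + q) = L p + L q) ->
  (forall phi p, phi \is symmetric -> L (phi * p) = meval w phi * L p) ->
  exists c : 'S_n -> F, forall p, L p = \sum_s c s * meval w (msym s p).
Proof.
move=> LD Lsym; pose B := orbit_mx separating.
have L0 : L 0 = 0.
  have := LD 0 0; rewrite addr0 => /eqP.
  by rewrite -subr_eq0 opprD addrA subrr add0r oppr_eq0 => /eqP.
have Lsum (g : 'I_N -> P) : L (\sum_j g j) = \sum_j L (g j).
  by elim/big_rec2: _ => // i x y _ <-; rewrite LD.
have dB : \det B != 0.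
  by apply: contraNneq orbit_det_neq0; rewrite -/B => ->; rewrite meval0.
pose d := meval w (\det B).
have d0 : d != 0 by exact: orbit_det_neq0.
pose c (i : 'I_N) := d^-1 * \sum_j meval w ((\adj B) j i) * L (separating j).
exists (fun s => c (enum_rank s)) => p.
have := congr1 L (cramer_expansion separating p).
rewrite Lsym ?det_orbit_sym// Lsum rmorphXn/= -/B -/d => e.
apply: (mulfI (expf_neq0 2 d0)); rewrite e.
rewrite (eq_bigr (fun j => \sum_i
  d * (meval w ((\adj B) j i) * meval w (msym (enum_val i) p)) * L (separating j))); last first.
  move=> j _; rewrite Lsym ?cramer_coef_sym//; rewrite -mulr_suml; congr (_ * _).
  rewrite mxE rmorphM/= -/B -/d -mulr_sumr mxE rmorph_sum/=; congr (_ * _).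
  by apply: eq_bigr => i _; rewrite rmorphM/= [orbit_col p i 0]mxE.
rewrite exchange_big/= mulr_sumr.
rewrite [RHS](reindex (enum_val : 'I_N -> 'S_n))/=; last first.
  by exists enum_rank => s _; [exact: enum_valK|exact: enum_rankK].
apply: eq_bigr => i _; rewrite enum_valK /c.
move: (d) d0 (meval w (msym (enum_val i) p)) => u u0 x.
rewrite expr2 -!mulrA mulVKf//.
by rewrite mulr_suml mulr_sumr; apply: eq_bigr => j _; ring.
Qed.

End SymmetricEigenfunctionals.

(** * Equivalent submodules *)

Section ModuleEquivalence.
Variables (R : realType) (n : nat) (lam : R).
Local Notation C := (Cplx R).
Local Notation D := (polydisc R n).
Local Notation coord := Defs.coord.
Local Notation K := (bergman_kernel lam).
Hypothesis lam_gt0 : 0 < lam.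
Variables (A : set (D -> C)) (ip : (D -> C) -> (D -> C) -> C).
Hypothesis hB : is_bergman_space lam A ip.

Let hA : is_hilbert_function_space A ip. Proof. by case: hB. Qed.
Let hK : has_reproducing_kernel A ip K. Proof. by case: hB. Qed.
Let KA w : A (K^~ w). Proof. by have [] := hK w. Qed.
Let Krepr w f : A f -> f w = ip f (K^~ w). Proof. by have [_ h] := hK w; exact: h. Qed.

Implicit Types (a b : 'S_n -> C) (f g : D -> C) (phi : mpoly.mpoly n C).

Lemma gavg_in a f : A f -> A (gavg a f).
Proof. by move=> Af; apply: (hfs_sum hA) => s; exact: (perm_in lam_gt0 hB). Qed.

(** Permutations act isometrically, so the adjoint of s is its inverse, and the conjugation rule for
    a matches the coefficients. *)
Lemma ip_gavg a f g : projector a -> A f -> A g -> ip (gavg a f) g = ip f (gavg a g).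
Proof.
move=> [_ aconj] Af Ag; have Ap s h : A h -> A (fun z => h (perm_pt s z)).
  exact: (perm_in lam_gt0 hB).
rewrite (ip_suml hA)//; last by move=> s; exact: Ap.
rewrite (ip_sumr hA)//; last by move=> s; exact: Ap.
rewrite [RHS](reindex_inj invg_inj)/=; apply: eq_bigr => s _.
rewrite aconj conjCK invgK; congr (_ * _).
rewrite -(ip_perm lam_gt0 hB s (Ap s^-1%g f Af) Ag); congr ip.
by apply/funext => z; rewrite perm_pt_comp mulgV perm_pt1.
Qed.

Lemma meval_perm_pt phi s (z : D) :
  meval (coord (perm_pt s z)) phi = meval (coord z) (msym s^-1%g phi).
Proof. by rewrite meval_msym; apply: meval_eq => j; rewrite coord_perm. Qed.

Lemma meval_sym phi s (z : D) : phi \is symmetric ->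
  meval (coord (perm_pt s z)) phi = meval (coord z) phi.
Proof. by move=> /issymP sym; rewrite meval_perm_pt sym. Qed.

Lemma gavg_poly_act a phi f : phi \is symmetric ->
  gavg a (poly_act phi f) = poly_act phi (gavg a f).
Proof.
move=> sym; apply/funext => z; rewrite /gavg /poly_act mulr_sumr.
by apply: eq_bigr => s _; rewrite meval_sym// mulrCA.
Qed.

Lemma gavg_lin a (c : C) f g :
  gavg a (fun z => c * f z + g z) = (fun z => c * gavg a f z + gavg a g z).
Proof.
apply/funext => z; rewrite /gavg mulr_sumr -big_split/=.
by apply: eq_bigr => s _; rewrite mulrDr mulrCA.
Qed.

Definition gmodule a : set (D -> C) := gavg a @` A.

Lemma gmoduleP a f : projector a -> gmodule a f <-> A f /\ gavg a f = f.
Proof.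
move=> pa; split=> [[g Ag <-]|[Af <-]]; last by exists f.
by split; [exact: gavg_in | rewrite gavg_idem].
Qed.

Lemma gmodule_lin a (c : C) f g : projector a ->
  gmodule a f -> gmodule a g -> gmodule a (fun z => c * f z + g z).
Proof.
move=> pa /(gmoduleP _ pa)[Af fE] /(gmoduleP _ pa)[Ag gE]; apply/gmoduleP => //.
by split; [exact: (hfs_lin hA) | rewrite gavg_lin fE gE].
Qed.

Lemma gmodule_poly_act a phi f : projector a -> phi \is symmetric ->
  gmodule a f -> gmodule a (poly_act phi f).
Proof.
move=> pa sym /(gmoduleP _ pa)[Af fE]; apply/gmoduleP => //.
by split; [exact: (poly_act_in lam_gt0 hB) | rewrite gavg_poly_act// fE].
Qed.

(** The inverse of U inherits every property, U being injective as an isometry. This allows the rank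
    comparison in both directions. *)
Lemma module_equiv_sym a b : projector a -> projector b ->
  module_equiv ip (gmodule a) (gmodule b) -> module_equiv ip (gmodule b) (gmodule a).
Proof.
move=> pa pb [U [Uim Ulin Uip Uact]].
(* A preimage is chosen where one exists, with default value 0 elsewhere. *)
pose V g := xget (fun=> 0) [set f | gmodule a f /\ U f = g].
have Ma f : gmodule a f -> A f by case/(gmoduleP _ pa).
have VP g : gmodule b g -> gmodule a (V g) /\ U (V g) = g.
  by rewrite -Uim => -[f Mf <-]; apply: (@xgetPex _ _ [set h | gmodule a h /\ U h = U f]); exists f.
have UM f : gmodule a f -> gmodule b (U f) by rewrite -Uim => Mf; exists f.
have Uinj f g : gmodule a f -> gmodule a g -> U f = U g -> f = g.
  move=> Mf Mg Ufg; have Af := Ma f Mf; have Ag := Ma g Mg.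
  have : (fun z => f z - g z) = (fun=> 0).
    apply: (hfs_ip_def hA); first exact: (hfs_sub hA).
    rewrite (ip_sub_self hA)// -[ip f f]Uip// -[ip f g]Uip// -[ip g f]Uip// -[ip g g]Uip//.
    by rewrite Ufg; ring.
  by move=> fg; apply/funext => z; apply/eqP; rewrite -subr_eq0; exact/eqP/(congr1 (@^~ z) fg).
exists V; split.
- apply/seteqP; split=> [_ [g Mg <-]|f Mf]; first by have [] := VP g Mg.
  exists (U f); first exact: UM.
  have [MV UV] := VP (U f) (UM f Mf); exact: Uinj.
- move=> c f g Mf Mg; have [MVf UVf] := VP f Mf; have [MVg UVg] := VP g Mg.
  have [MV UV] := VP _ (gmodule_lin c pb Mf Mg).
  by apply: Uinj => //; [exact: gmodule_lin | rewrite Ulin// UV UVf UVg].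
- move=> f g Mf Mg; have [MVf UVf] := VP f Mf; have [MVg UVg] := VP g Mg.
  by rewrite -[LHS]Uip// UVf UVg.
- move=> phi sym f Mf; have [MVf UVf] := VP f Mf.
  have [MV UV] := VP _ (gmodule_poly_act pb sym Mf).
  by apply: Uinj => //; [exact: gmodule_poly_act | rewrite Uact// UV UVf].
Qed.

Lemma kernel_perm s (z w : D) : K (perm_pt s z) (perm_pt s w) = K z w.
Proof.
rewrite /bergman_kernel [LHS](reindex_inj (@perm_inj _ s))/=.
by apply: eq_bigr => j _; rewrite !coord_perm permK.
Qed.

Lemma generic_subproof : in_polydisc (\row_(j < n) (j.+2%:R^-1 : C)).
Proof.
apply/forallP => j; rewrite mxE ger0_norm ?invr_ge0 ?ler0n//.
by rewrite invf_lt1 ?ltr0n// ltr1n.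
Qed.

(** The point (1/2, 1/3, ...), with distinct coordinates; starting at 1/2 keeps it off the
    boundary. *)
Definition generic_pt : D := exist (fun x : 'rV[C]_n => in_polydisc x) _ generic_subproof.

Local Notation w := generic_pt.
Local Notation N := #|{: 'S_n}|.

Lemma coord_generic_inj : injective (coord w).
Proof.
move=> i j; rewrite /coord !mxE => /invr_inj/eqP; rewrite eqr_nat => /eqP[ij].
exact: val_inj.
Qed.

Definition orbit_comb (x : 'rV[C]_N) : D -> C :=
  fun z => \sum_i x 0 i * K z (perm_pt (enum_val i) w).

Lemma orbit_comb_in x : A (orbit_comb x).
Proof. by apply: (hfs_sum hA) => i; exact: KA. Qed.

Lemma ip_orbit_comb f x : A f ->
  ip f (orbit_comb x) = \sum_i (x 0 i)^* * f (perm_pt (enum_val i) w).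
Proof.
move=> Af; rewrite (ip_sumr hA)//.
by apply: eq_bigr => i _; rewrite -Krepr.
Qed.

(** The kernels along the orbit are linearly independent because polynomials separate its points. *)
Lemma orbit_comb_eq0 x : orbit_comb x = (fun=> 0) -> x = 0.
Proof.
move=> x0; apply/rowP => i; rewrite mxE.
have [p [pi p0]] := orbit_separation coord_generic_inj (enum_val i)^-1%g.
have Ap := polyfun_in lam_gt0 hB p.
have := ip_orbit_comb x Ap; rewrite x0 (hfs_ip_conj hA (hfs_zero hA) Ap) (ip0l hA)// conjC0.
rewrite (bigD1 i)//= big1 => [|j ji].
  rewrite addr0 /polyfun meval_perm_pt => /esym/eqP; rewrite mulf_eq0 (negPf pi) orbF conjC_eq0.
  by move/eqP.
by rewrite /polyfun meval_perm_pt p0 ?mulr0// (inj_eq invg_inj) (inj_eq enum_val_inj).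
Qed.

Lemma orbit_combB x y z : orbit_comb (x - y) z = orbit_comb x z - orbit_comb y z.
Proof.
by rewrite /orbit_comb -sumrB; apply: eq_bigr => i _; rewrite !mxE mulrBl.
Qed.

Lemma orbit_comb_inj : injective orbit_comb.
Proof.
move=> x y xy; apply/eqP; rewrite -subr_eq0; apply/eqP/orbit_comb_eq0/funext => z.
by rewrite orbit_combB xy subrr.
Qed.

(** Invariance of the kernel under simultaneous permutations moves the action from the variable to
    the orbit point, where it is right multiplication in the group. *)
Lemma gavg_orbit_comb a x : gavg a (orbit_comb x) = orbit_comb (x *m gmatrix a).
Proof.
apply/funext => z; rewrite /gavg /orbit_comb.
under eq_bigr => s _ do rewrite mulr_sumr.
rewrite exchange_big/=; under [RHS]eq_bigr => j _ do rewrite mxE mulr_suml.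
rewrite [RHS]exchange_big/=; apply: eq_bigr => i _.
rewrite (reindex_inj (mulgI (enum_val i)^-1%g))/=.
rewrite (reindex (enum_val : 'I_N -> 'S_n))/=; last first.
  by exists enum_rank => s _; [exact: enum_valK|exact: enum_rankK].
apply: eq_bigr => j _; rewrite mxE mulrCA mulrA; congr (_ * _).
rewrite -(kernel_perm ((enum_val i)^-1 * enum_val j)%g) !perm_pt_comp.
by rewrite mulVg perm_pt1 mulKVg.
Qed.

Lemma orbit_comb_mulmx (m : nat) (y : 'rV[C]_m) (B : 'M[C]_(m, N)) :
  orbit_comb (y *m B) = (fun z => \sum_k y 0 k * orbit_comb (row k B) z).
Proof.
apply/funext => z; rewrite /orbit_comb.
under eq_bigr => i _ do rewrite mxE mulr_suml.
rewrite exchange_big/=; apply: eq_bigr => k _; rewrite mulr_sumr.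
by apply: eq_bigr => i _; rewrite mxE mulrA.
Qed.

(* A vector [h] on which the adjoints of the symmetric polynomials act through
   evaluation at [w] is a combination of kernels along the orbit of [w]. *)
Lemma joint_eigenvector h : A h ->
  (forall phi p, phi \is symmetric ->
    ip (polyfun (phi * p)) h = meval (coord w) phi * ip (polyfun p) h) ->
  exists x, h = orbit_comb x.
Proof.
move=> Ah eig; have Ap p := polyfun_in lam_gt0 hB p.
have LD p q : ip (polyfun (p + q)) h = ip (polyfun p) h + ip (polyfun q) h.
  rewrite -(ip_addl hA)//; congr ip; apply/funext => z; exact: mevalD.
have [c cE] := symmetric_eigenfunctional coord_generic_inj LD eig.
pose x : 'rV[C]_N := \row_i (c (enum_val i)^-1%g)^*.
exists x; have Ax := orbit_comb_in x.
have : (fun z => h z - orbit_comb x z) = (fun=> 0).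
  apply: (polyfun_dense lam_gt0 hB); first exact: (hfs_sub hA).
  move=> p; rewrite (ip_subr hA)// cE ip_orbit_comb//.
  rewrite (reindex_inj invg_inj)/= (reindex (enum_val : 'I_N -> 'S_n))/=; last first.
    by exists enum_rank => s _; [exact: enum_valK|exact: enum_rankK].
  apply/eqP; rewrite subr_eq0; apply/eqP/eq_bigr => i _.
  by rewrite mxE conjCK /polyfun meval_perm_pt.
by move=> hx; apply/funext => z; apply/eqP; rewrite -subr_eq0; exact/eqP/(congr1 (@^~ z) hx).
Qed.

(** The rows of [gmatrix b] are the projected kernels of the second module. Their preimages under U
    are joint eigenvectors, hence orbit combinations with coordinate matrix B in the row space of
    [gmatrix a]. A linear relation between the rows of B passes through U to the rows of
    [gmatrix b], so rank [gmatrix b] <= rank B <= rank [gmatrix a]. *)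
Lemma module_equiv_rank a b : projector a -> projector b ->
  module_equiv ip (gmodule a) (gmodule b) -> (\rank (gmatrix b) <= \rank (gmatrix a))%N.
Proof.
move=> pa pb [U [Uim Ulin Uip Uact]].
have UM f : gmodule a f -> gmodule b (U f) by rewrite -Uim => Mf; exists f.
have Mk i : gmodule b (orbit_comb (row i (gmatrix b))).
  apply/gmoduleP => //; split; first exact: orbit_comb_in.
  by rewrite gavg_orbit_comb -row_mul gmatrix_idem.
have h_ex i : exists h, gmodule a h /\ U h = orbit_comb (row i (gmatrix b)).
  by have := Mk i; rewrite -Uim => -[h Mh Uh]; exists h.
pose h i := sval (cid (h_ex i)).
have Mh i : gmodule a (h i) by have [] := svalP (cid (h_ex i)).
have Uh i : U (h i) = orbit_comb (row i (gmatrix b)) by have [] := svalP (cid (h_ex i)).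
have kernelE i : orbit_comb (row i (gmatrix b)) = gavg b (K^~ (perm_pt (enum_val i) w)).
  rewrite (_ : K^~ _ = orbit_comb (delta_mx 0 i)); last first.
    apply/funext => z; rewrite /orbit_comb (bigD1 i)//= big1 ?addr0.
      by rewrite mxE !eqxx mul1r.
    by move=> j /negPf ji; rewrite mxE ji andbF mul0r.
  by rewrite gavg_orbit_comb -rowE.
(* The inner product with [h i] is moved into the first module by self-adjointness, then into the
   second by U. There it is evaluation at an orbit point, where a symmetric polynomial takes its
   value at w. *)
have x_ex i : exists x, h i = orbit_comb x.
  have /(gmoduleP _ pa)[Ah hE] := Mh i.
  apply: joint_eigenvector => // phi p sym.
  have Ap q := polyfun_in lam_gt0 hB q.
  have pE : polyfun (phi * p) = poly_act phi (polyfun p).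
    by apply/funext => z; exact: mevalM.
  have Mg : gmodule a (gavg a (polyfun p)) by exists (polyfun p).
  have eval g : gmodule b g -> ip g (U (h i)) = g (perm_pt (enum_val i) w).
    move=> /(gmoduleP _ pb)[Ag gE]; rewrite Uh kernelE -(ip_gavg pb)// gE.
    by rewrite -Krepr.
  rewrite -hE -!(ip_gavg pa)// pE gavg_poly_act//.
  rewrite -Uip//; last exact: gmodule_poly_act.
  rewrite -[X in _ = _ * X]Uip// Uact// !eval//; try exact: UM.
    by rewrite /poly_act meval_sym.
  by apply: gmodule_poly_act => //; exact: UM.
pose x i := sval (cid (x_ex i)).
have xE i : h i = orbit_comb (x i) by exact: svalP (cid (x_ex i)).
pose B := \matrix_i x i.
have BQ : B *m gmatrix a = B.
  apply/row_matrixP => i; rewrite row_mul rowK; apply: orbit_comb_inj.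
  by rewrite -gavg_orbit_comb -xE; have /(gmoduleP _ pa)[] := Mh i.
apply: (@leq_trans (\rank B)); last by rewrite -BQ mxrankM_maxr.
have U0 : U (fun=> 0) = (fun=> 0).
  have Z : gmodule a (fun=> 0).
    apply/gmoduleP => //; split; first exact: hfs_zero hA.
    by apply/funext => z; rewrite /gavg big1// => s _; rewrite mulr0.
  have := Ulin (-1) _ _ Z Z.
  rewrite (_ : (fun z => _) = (fun=> 0)); last by apply/funext => z; rewrite mulr0 addr0.
  by move=> ->; apply/funext => z; rewrite mulN1r addNr.
have Usum (s : seq 'I_N) (y : 'rV[C]_N) :
    gmodule a (fun z => \sum_(k <- s) y 0 k * h k z) /\
    U (fun z => \sum_(k <- s) y 0 k * h k z) = (fun z => \sum_(k <- s) y 0 k * U (h k) z).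
  elim: s => [|k s [Ms Us]].
    rewrite (_ : (fun z => _) = (fun=> 0)); last by apply/funext => z; rewrite big_nil.
    rewrite U0; split; last by apply/funext => z; rewrite big_nil.
    apply/gmoduleP => //; split; first exact: hfs_zero hA.
    by apply/funext => z; rewrite /gavg big1// => t _; rewrite mulr0.
  rewrite (_ : (fun z => _) = (fun z => y 0 k * h k z + \sum_(k <- s) y 0 k * h k z)); last first.
    by apply/funext => z; rewrite big_cons.
  split; first exact: gmodule_lin.
  by rewrite Ulin// Us; apply/funext => z; rewrite big_cons.
have ker (y : 'rV[C]_N) : y *m B = 0 -> y *m gmatrix b = 0.
  move=> yB; apply: orbit_comb_eq0; rewrite orbit_comb_mulmx.
  have [_] := Usum (index_enum 'I_N) y.
  rewrite (_ : (fun z => \sum_k y 0 k * h k z) = (fun=> 0)).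
    by rewrite U0 => /esym; under eq_fun => z do under eq_bigr => k _ do rewrite Uh.
  have := orbit_comb_mulmx y B; rewrite yB => e.
  transitivity (orbit_comb 0); last first.
    by apply/funext => z; rewrite /orbit_comb big1// => i _; rewrite mxE mul0r.
  by rewrite e; apply/funext => z; apply: eq_bigr => k _; rewrite xE rowK.
exact: mxrank_le_ker ker.
Qed.

Lemma module_equiv_rank_eq a b : projector a -> projector b ->
  module_equiv ip (gmodule a) (gmodule b) -> n`!%:R * a 1%g = n`!%:R * b 1%g.
Proof.
move=> pa pb ab; rewrite -!gmatrix_rank//; congr _%:R; apply/eqP.
rewrite eqn_leq; apply/andP; split.
  exact: module_equiv_rank pb pa (module_equiv_sym pa pb ab).
exact: module_equiv_rank pa pb ab.
Qed.

End ModuleEquivalence.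

Theorem theorem4p1 (R : realType) (n : nat) (lam : R)
    (A : set (polydisc R n -> Cplx R))
    (ip : (polydisc R n -> Cplx R) -> (polydisc R n -> Cplx R) -> Cplx R)
    (p q : seq nat) (dp dq : nat)
    (pi_p : mx_representation (Cplx R) [group of [set: 'S_n]] dp)
    (pi_q : mx_representation (Cplx R) [group of [set: 'S_n]] dq) :
  (1 <= n)%N -> 0 < lam ->
  is_bergman_space lam A ip ->
  is_partition n p -> is_partition n q ->
  unitary_irrep_of pi_p p -> unitary_irrep_of pi_q q ->
  chi pi_p 1%g <> chi pi_q 1%g ->
  (forall (i : 'I_dp) (j : 'I_dq),
     ~ module_equiv ip (Pij pi_p i i @` A) (Pij pi_q j j @` A)) /\
  ~ module_equiv ip (Pp pi_p @` A) (Pp pi_q @` A).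
Proof.
move=> _ lam_gt0 hB _ _ [irrp _ up] [irrq _ uq]; rewrite !chi1 => dpq.
split=> [i j|]; [rewrite !Pij_gavg | rewrite !Pp_gavg].
- move=> /(module_equiv_rank_eq lam_gt0 hB (projector_ii irrp up i) (projector_ii irrq uq j)).
  by rewrite !coef_ii1.
- move=> /(module_equiv_rank_eq lam_gt0 hB (projector_sum irrp up) (projector_sum irrq uq)).
  (* The rank attached to [Pp] is a sum of d terms equal to d, so the comparison is between the
     squares of the two dimensions. *)
  rewrite !mulr_sumr; under eq_bigr => i _ do rewrite coef_ii1.
  under [X in _ = X]eq_bigr => i _ do rewrite coef_ii1.
  rewrite !sumr_const !card_ord -!mulrnA => /eqP; rewrite eqr_nat => /eqP dd.
  apply: dpq; congr _%:R; apply/eqP; rewrite -(eqn_sqr dp dq).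
  by rewrite -!mulnn dd.
Qed.
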